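(* Let $A$ and $B$ be finitely generated groups. (1) If $B$ is not virtually cyclic, then for any $x$ of infinite order in the centre of $B$ we have $\mathrm{CLF}_{A\wr B}(n)\succeq\delta_{\langle x\rangle}^B(n)$. (2) If $B$ contains a copy of $\mathbb{Z}^2$ (i.e. a subgroup isomorphic to $\mathbb{Z}^2$), then $\mathrm{CLF}_{A\wr B}(n)\succeq n^2$. (3) In particular, for $r\geq 2$ there is some $\alpha\in[2,3]$ such that $\mathrm{CLF}_{A\wr\mathbb{Z}^r}(n)\asymp n^\alpha$.
   Context: $A\wr B=A^{(B)}\rtimes B$ is the restricted wreath product: $A^{(B)}$ is the group of finitely supported functions $B\to A$ under pointwise multiplication, elements are pairs $(f,b)$, and $(f,b)(g,c)=(fg^b,bc)$ with $g^b(x)=g(b^{-1}x)$. It is finitely generated when $A$ and $B$ are. For a group $G$ with a finite generating set and word length $|\cdot|$, the conjugacy length function is $$\mathrm{CLF}_G(n)=\max\{\min\{|w| : wu=vw\} : |u|+|v|\leq n,\ u \text{ conjugate to } v \text{ in } G\}.$$ For a finitely generated subgroup $H\leq G$, the subgroup distortion function is $\delta_H^G(n)=\max\{d_H(e_G,h) : h\in H,\ d_G(e_G,h)\leq n\}$, where $d_H,d_G$ are word metrics. For functions $f,g:\mathbb{N}\to[0,\infty)$ write $f\preceq g$ (equivalently $g\succeq f$) if there is an integer $C>0$ such that $f(n)\leq Cg(Cn)$ for all $n\in\mathbb{N}$, and $f\asymp g$ if $f\preceq g$ and $g\preceq f$.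
   Formalization: A is assumed nontrivial (for A=1, B=Z^2 the CLF is 0); in (3) it is also assumed that CLF_A ≼ n^2 or CLF_A ≍ n^b for some b in [2,3], since CLF_A ≼ CLF_{A≀Z^r} makes (3) false otherwise, e.g. if A has solvable word but unsolvable conjugacy problem. *)

(* Defs.v *)
(* MathComp and MathComp-Analysis; groups are possibly infinite [groupType]s. *)
From HB Require Import structures.
From mathcomp Require Import all_boot all_order all_algebra finmap.
From mathcomp Require Import all_classical all_reals all_analysis.

Set Implicit Arguments.
Unset Strict Implicit.
Unset Printing Implicit Defensive.

Import Order.TTheory GRing.Theory Num.Theory.

Local Open Scope group_scope.
Local Open Scope classical_set_scope.

Section FinitelySupported.
Variables A B : groupType.

Definition fsfun_one : {fsfun B -> A with 1} := [fsfun with 1].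

Definition fsfun_mul (f g : {fsfun B -> A with 1}) : {fsfun B -> A with 1} :=
  [fsfun x in (finsupp f `|` finsupp g)%fset => f x * g x | 1].

Definition fsfun_inv (f : {fsfun B -> A with 1}) : {fsfun B -> A with 1} :=
  [fsfun x in finsupp f => (f x)^-1 | 1].

Definition fsfun_shift (b : B) (g : {fsfun B -> A with 1}) :
    {fsfun B -> A with 1} :=
  [fsfun x in [fset b * y | y in finsupp g]%fset => g (b^-1 * x) | 1].

Lemma fsfun_oneE x : fsfun_one x = 1.
Proof. by rewrite fsfunE. Qed.

Lemma fsfun_mulE f g x : fsfun_mul f g x = f x * g x.
Proof.
rewrite fsfunE in_fsetU.
by case: finsuppP => _ //; case: finsuppP => _ //=; rewrite mulg1.
Qed.

Lemma fsfun_invE f x : fsfun_inv f x = (f x)^-1.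
Proof. by rewrite fsfunE; case: finsuppP => _ //; rewrite invg1. Qed.

Lemma fsfun_shiftE b g x : fsfun_shift b g x = g (b^-1 * x).
Proof.
rewrite fsfunE; case: ifPn => // /negP xNs.
case: finsuppP => // gx; case: xNs; apply/imfsetP.
by exists (b^-1 * x) => //; rewrite mulVKg.
Qed.

End FinitelySupported.

(* The underlying type of the restricted wreath product [A wr B]. It is a new
   constant so that it does not inherit the direct product structure of pairs. *)
Definition wreath (A B : groupType) : Type := ({fsfun B -> A with 1} * B)%type.

Section Wreath.
Variables A B : groupType.
Local Notation W := (wreath A B).

HB.instance Definition _ := Choice.copy W ({fsfun B -> A with 1} * B)%type.

Definition wreath_one : W := (fsfun_one A B, 1).

Definition wreath_mul (p q : W) : W :=
  (fsfun_mul p.1 (fsfun_shift p.2 q.1), p.2 * q.2).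

Definition wreath_inv (p : W) : W :=
  (fsfun_shift p.2^-1 (fsfun_inv p.1), p.2^-1).

Let wreath_mulA : associative wreath_mul.
Proof.
move=> [f a] [g b] [h c]; rewrite /wreath_mul /=; congr pair; last exact: mulgA.
apply/fsfunP => x; rewrite !(fsfun_mulE, fsfun_shiftE) -mulgA; congr (_ * (_ * _)).
by rewrite invgM mulgA.
Qed.

Let wreath_mul1 : left_id wreath_one wreath_mul.
Proof.
move=> [f b]; rewrite /wreath_mul /=; congr pair; last exact: mul1g.
by apply/fsfunP => x; rewrite fsfun_mulE fsfun_shiftE fsfun_oneE invg1 !mul1g.
Qed.

Let wreath_mulr1 : right_id wreath_one wreath_mul.
Proof.
move=> [f b]; rewrite /wreath_mul /=; congr pair; last exact: mulg1.
by apply/fsfunP => x; rewrite fsfun_mulE fsfun_shiftE fsfun_oneE mulg1.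
Qed.

Let wreath_mulV : left_inverse wreath_one wreath_inv wreath_mul.
Proof.
move=> [f b]; rewrite /wreath_mul /=; congr pair; last exact: mulVg.
apply/fsfunP => x; rewrite fsfun_mulE !fsfun_shiftE fsfun_oneE fsfun_invE.
by rewrite mulVg.
Qed.

Let wreath_mulrV : right_inverse wreath_one wreath_inv wreath_mul.
Proof.
move=> [f b]; rewrite /wreath_mul /=; congr pair; last exact: mulgV.
apply/fsfunP => x; rewrite fsfun_mulE !fsfun_shiftE fsfun_oneE fsfun_invE.
by rewrite invgK mulVKg mulgV.
Qed.

HB.instance Definition _ := isGroup.Build W
  wreath_mulA wreath_mul1 wreath_mulr1 wreath_mulV wreath_mulrV.

End Wreath.

(* The additive group Z^r as a multiplicatively written [groupType]. *)
Definition Zpow (r : nat) : Type := 'rV[int]_r.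

Section Zpow.
Variable r : nat.
Local Notation Z := (Zpow r).

HB.instance Definition _ := Choice.copy Z 'rV[int]_r.

Let Zmul (u v : Z) : Z := ((u : 'rV[int]_r) + v)%R.
Let Zinv (u : Z) : Z := (- (u : 'rV[int]_r))%R.
Let Zone : Z := (0 : 'rV[int]_r)%R.
Let ZmulA : associative Zmul. Proof. exact: addrA. Qed.
Let Zmul1 : left_id Zone Zmul. Proof. exact: add0r. Qed.
Let Zmulr1 : right_id Zone Zmul. Proof. exact: addr0. Qed.
Let ZmulV : left_inverse Zone Zinv Zmul. Proof. exact: addNr. Qed.
Let ZmulrV : right_inverse Zone Zinv Zmul. Proof. exact: addrN. Qed.

HB.instance Definition _ := isGroup.Build Z ZmulA Zmul1 Zmulr1 ZmulV ZmulrV.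

End Zpow.

Section GroupNotions.
Variable G : groupType.

Definition is_subgroup (H : set G) : Prop :=
  H 1 /\ forall x y, H x -> H y -> H (x / y).

Definition generated (S : seq G) : set G := smallest is_subgroup [set` S].

Definition finitely_generated : Prop := exists S, generated S = setT.

Definition finite_index (H : set G) : Prop :=
  finite_set [set [set x * h | h in H] | x in [set: G]].

Definition virtually_cyclic : Prop :=
  exists g : G, finite_index (generated [:: g]).

Definition infinite_order (x : G) : Prop := forall n, (0 < n)%N -> x ^+ n != 1.

Definition central (x : G) : Prop := forall y, commute x y.

Definition contains_copy_of (K : groupType) : Prop :=
  exists H : set G, is_subgroup H /\
  exists2 f : K -> G, {morph f : x y / x * y} & set_bij setT H f.

Definition conjugate (u v : G) : Prop := exists w, w * u = v * w.

(* [infimum 0] and [supremum 0] on sets of natural numbers are the minimum of a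
   nonempty set and the maximum of a nonempty bounded set (and 0 for the empty
   set). [word_length S g] is therefore meaningful for g in [generated S]. *)
Definition word_length (S : seq G) (g : G) : nat :=
  infimum 0%N [set size w | w in [set w : seq G |
    all (fun s => (s \in S) || (s^-1 \in S)) w /\ \prod_(s <- w) s = g]].

(* The balls of G are finite, so the outer [supremum] is over a finite set,
   nonempty because of u = v = 1. *)
Definition CLF (S : seq G) (n : nat) : nat :=
  supremum 0%N [set d | exists u v : G,
    [/\ (word_length S u + word_length S v <= n)%N, conjugate u v &
        d = infimum 0%N [set word_length S w | w in [set w | w * u = v * w]]]].

(* Distortion in G, with generators T, of the subgroup H generated by X: words
   in X represent the same elements in H and in G, so [word_length X] is the
   word length of H on H. *)
Definition distortion (T X : seq G) (n : nat) : nat :=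
  supremum 0%N [set word_length X h | h in
    [set h | generated X h /\ (word_length T h <= n)%N]].

End GroupNotions.

Arguments finitely_generated G : clear implicits.
Arguments virtually_cyclic G : clear implicits.
Arguments contains_copy_of G K : clear implicits.

Section Comparison.
Variable R : realType.
Local Open Scope ring_scope.

Definition preceq (f g : nat -> R) : Prop :=
  exists C : nat, (0 < C)%N /\ forall n : nat, f n <= C%:R * g (C * n)%N.

Definition asymp (f g : nat -> R) : Prop := preceq f g /\ preceq g f.

Definition CLFr (G : groupType) (S : seq G) : nat -> R := fun n => (CLF S n)%:R.

Definition distortionr (G : groupType) (T X : seq G) : nat -> R :=
  fun n => (distortion T X n)%:R.

Definition power (a : R) : nat -> R := fun n => n%:R `^ a.

Definition square : nat -> R := fun n => n%:R ^+ 2.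

(* CLF of A is dominated by CLF of A wr B whenever B is finitely generated.
   This condition on A is thus necessary for the CLF of A wr Z^r to be a power
   with exponent in [2, 3]; without it that claim fails, for example if A has
   unsolvable conjugacy problem and solvable word problem. *)
Definition moderate_CLF (A : groupType) : Prop :=
  exists2 S : seq A, generated S = setT &
    preceq (CLFr S) square \/
    exists2 b : R, 2 <= b <= 3 & asymp (CLFr S) (power b).

End Comparison.

(* Main.v *)
(* Lower bounds. Let [p] in [B] have infinite order, let [E] be a finite set of
   the form [{q ^ j}], and let [h] take the value [a != 1] on the [m |E|] points
   of [E], [p E], ..., [p ^ (m-1) E]. Then [h^-1 p h] differs from [p] only by
   lamps on [E] and [p ^ m E], so it is short when [E] and [p ^ m] are, whereas
   [p] commutes with no nontrivial element of the base group, so that every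
   element conjugating [h^-1 p h] to [p] has [m |E|] nontrivial lamps. A single
   point [E] gives the distortion of [<p>], and [m = |E| = n] in a copy of Z^2
   gives [n ^ 2].

   Upper bound for [B = Z^r]. Let [(h, z) (f, b) = (g, b) (h, z)] with both
   sides of length at most [n]. If [b] is nontrivial, [z] may be changed by
   powers of [b] so that its norm is O(n), and [h] is then determined by
   [f] and [g]: it is a quotient of two functions obtained by pushing every lamp
   down its coset of [<b>] to a fixed level, and each lamp [a] pushed costs
   O(n (1 + |a|)), so O(n ^ 2) altogether. If [b] is trivial, the lamps are
   conjugated pointwise, at the cost of O(n ^ 2) for the moves and a sum of values
   of [CLF_A]. Hence the exponent is 2 if [CLF_A] is at most quadratic, and that of
   [CLF_A] otherwise. *)
Require Import Defs.
From mathcomp Require Import all_boot all_order all_algebra finmap.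
From mathcomp Require Import all_classical all_reals all_analysis.
From mathcomp Require Import zify ring lra.

Set Implicit Arguments.
Unset Strict Implicit.
Unset Printing Implicit Defensive.
Import Order.TTheory GRing.Theory Num.Theory.
Local Open Scope classical_set_scope.
Local Open Scope group_scope.

(** * Word length and conjugacy length *)

Lemma infimum_natP (A : set nat) : A !=set0 ->
  A (infimum 0%N A) /\ lbound A (infimum 0%N A).
Proof.
move=> A0; have exA : exists n, `[< A n >] by case: A0 => n An; exists n; apply/asboolP.
case: (ex_minnP exA) => m /asboolP Am mmin.
have Im : infimums A m.
  split=> [n An|n /(_ _ Am)//].
  by apply: mmin; apply/asboolP.
rewrite /infimum; case: ifPn => [/eqP A0'|_]; first by case: A0 => n; rewrite A0'.
case: xgetP => [y _ Iy|/(_ m)//].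
by rewrite (is_subset1_infimums Iy Im); split=> // n An; apply: mmin; apply/asboolP.
Qed.

Lemma infimum_nat_le (A : set nat) n : A n -> (infimum 0%N A <= n)%N.
Proof. by move=> An; have [_] := infimum_natP (ex_intro _ n An); apply. Qed.

(** Boundedness is what matters: without a supremum the default value 0 would be returned. *)
Lemma supremum_nat_ge (A : set nat) N n :
  (forall k, A k -> (k <= N)%N) -> A n -> (n <= supremum 0%N A)%N.
Proof.
move=> AN An; apply: (@ge_supremum_Nmem _ nat) => //.
by apply: nat_supremums_neq0; exists N.
Qed.

Lemma supremum_nat_le (A : set nat) N :
  (forall k, A k -> (k <= N)%N) -> (supremum 0%N A <= N)%N.
Proof.
move=> AN; rewrite /supremum; case: ifPn => // _.
by case: xgetP => [y _ [_]|//]; apply.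
Qed.

Section WordLength.
Variable G : groupType.
Implicit Types (S : seq G) (g h : G) (w : seq G).

Definition is_word S w := all (fun s => (s \in S) || (s^-1 \in S)) w.

Lemma generated_subgroup S : is_subgroup (generated S).
Proof.
split=> [M [[] //]|x y xS yS M [Mgrp SM]].
by case: (Mgrp) => _; apply; [exact: xS|exact: yS].
Qed.

Lemma generatedM S x y : generated S x -> generated S y -> generated S (x * y).
Proof.
have [S1 SV] := generated_subgroup S => xS yS.
by rewrite -[y]invgK; apply: (SV) => //; rewrite -[y^-1]mul1g; exact: SV.
Qed.

Lemma generatedV S x : generated S x -> generated S x^-1.
Proof.
have [S1 SV] := generated_subgroup S => xS.
by rewrite -[_^-1]mul1g; apply: SV.
Qed.

Lemma generated_mem S x : x \in S -> generated S x.
Proof. by move=> xS M [_]; apply. Qed.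

Lemma generatedX S x n : generated S x -> generated S (x ^+ n).
Proof.
move=> xS; elim: n => [|n IHn]; first exact: (generated_subgroup S).1.
by rewrite expgS; exact: generatedM.
Qed.

Lemma prodV_rev w : (\prod_(s <- w) s)^-1 = \prod_(s <- rev ([seq x^-1 | x <- w])) s.
Proof.
elim: w => [|s w IHw]; first by rewrite !big_nil invg1.
by rewrite big_cons invgM IHw map_cons rev_cons -cats1 big_cat /= big_seq1.
Qed.

Lemma is_wordV S w : is_word S (rev ([seq x^-1 | x <- w])) = is_word S w.
Proof.
rewrite /is_word all_rev all_map; apply: eq_all => s /=.
by rewrite invgK orbC.
Qed.

Lemma generatedP S g :
  generated S g <-> exists2 w, is_word S w & \prod_(s <- w) s = g.
Proof.
split=> [|[w Sw <-]]; last first.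
  elim: w Sw => [_|s w IHw /= /andP[sS /IHw wS]].
    by rewrite big_nil; exact: (generated_subgroup S).1.
  rewrite big_cons; apply: generatedM => //.
  case/orP: sS => /generated_mem // sS.
  by rewrite -[s]invgK; exact: generatedV.
pose M : set G := [set h | exists2 w, is_word S w & \prod_(s <- w) s = h].
move=> gS; apply: (smallest_sub (X := M)) gS; last first.
  by move=> s /= sS; exists [:: s]; rewrite /is_word /= ?sS // big_seq1.
split=> [|x y [w wS <-] [w' w'S <-]]; first by exists [::]; rewrite // big_nil.
exists (w ++ rev ([seq x^-1 | x <- w'])); last by rewrite big_cat /= prodV_rev.
by rewrite /is_word all_cat; apply/andP; split=> //; rewrite -/(is_word _ _) is_wordV.
Qed.

Lemma word_length_le S w : is_word S w ->
  (word_length S (\prod_(s <- w) s) <= size w)%N.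
Proof. by move=> wS; apply: infimum_nat_le; exists w. Qed.

Lemma word_lengthP S g : generated S g -> exists w,
  [/\ is_word S w, \prod_(s <- w) s = g & size w = word_length S g].
Proof.
case/generatedP=> w wS wg; rewrite /word_length; set E := image _ _.
have /infimum_natP[] : E !=set0 by exists (size w); exists w.
by case=> w' [w'S w'g] <- _; exists w'.
Qed.

Lemma word_length1 S : word_length S 1 = 0%N.
Proof.
by apply/eqP; rewrite -leqn0; have := @word_length_le S [::] isT; rewrite big_nil.
Qed.

Lemma word_lengthM_in S g h : generated S g -> generated S h ->
  (word_length S (g * h) <= word_length S g + word_length S h)%N.
Proof.
move=> /word_lengthP[w [wS <- <-]] /word_lengthP[w' [w'S <- <-]].
by rewrite -size_cat -big_cat /=; apply: word_length_le; rewrite /is_word all_cat; apply/andP.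
Qed.

Lemma word_lengthV_in S g : generated S g -> word_length S g^-1 = word_length S g.
Proof.
move=> gS; suff le_inv k : generated S k -> (word_length S k^-1 <= word_length S k)%N.
  by apply/eqP; rewrite eqn_leq le_inv // -{1}[g]invgK le_inv //; exact: generatedV.
move=> /word_lengthP[w [wS <- <-]]; rewrite prodV_rev.
have := @word_length_le S (rev [seq x^-1 | x <- w]).
by rewrite is_wordV size_rev size_map; apply.
Qed.

Lemma word_lengthX_in S g n : generated S g ->
  (word_length S (g ^+ n) <= n * word_length S g)%N.
Proof.
move=> gS; elim: n => [|n IHn]; first by rewrite expg0 word_length1.
rewrite expgS mulSn (leq_trans (word_lengthM_in gS _)) ?leq_add2l //.
exact: generatedX.
Qed.

Section Gen.
Variable S : seq G.
Hypothesis genS : generated S = setT.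
Local Notation wl := (word_length S).

Let wlP g : exists w,
  [/\ is_word S w, \prod_(s <- w) s = g & size w = wl g].
Proof. by apply: word_lengthP; rewrite genS. Qed.

Lemma word_length_eq0 g : wl g = 0%N -> g = 1.
Proof. by have [w [_ <- <-]] := wlP g => /size0nil ->; rewrite big_nil. Qed.

Lemma word_length_gt0 g : g != 1 -> (0 < wl g)%N.
Proof. by rewrite lt0n; apply: contraNneq => /word_length_eq0 ->. Qed.

Let gen g : generated S g. Proof. by rewrite genS. Qed.

Lemma word_lengthM g h : (wl (g * h) <= wl g + wl h)%N.
Proof. exact: word_lengthM_in. Qed.

Lemma word_lengthV g : wl g^-1 = wl g.
Proof. exact: word_lengthV_in. Qed.

Lemma word_lengthX g n : (wl (g ^+ n) <= n * wl g)%N.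
Proof. exact: word_lengthX_in. Qed.

Lemma word_lengthM_le g h m n :
  (wl g <= m)%N -> (wl h <= n)%N -> (wl (g * h) <= m + n)%N.
Proof. by move=> gm hn; apply: leq_trans (word_lengthM g h) _; exact: leq_add. Qed.

Lemma word_lengthV_le g n : (wl g <= n)%N -> (wl g^-1 <= n)%N.
Proof. by rewrite word_lengthV. Qed.

Lemma word_lengthX_le g m n : (wl g <= m)%N -> (wl (g ^+ n) <= n * m)%N.
Proof.
by move=> gm; apply: leq_trans (word_lengthX g n) _; rewrite leq_mul2l gm orbT.
Qed.

Lemma finite_ball n : exists s : seq G, forall g, (wl g <= n)%N -> g \in s.
Proof.
pose S' := S ++ [seq x^-1 | x <- S].
suff [s ss] : exists s : seq G, forall w, is_word S w -> (size w <= n)%N ->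
    \prod_(x <- w) x \in s.
  by exists s => g; have [w [wS <- <-]] := wlP g; exact: ss.
elim: n => [|n [s IHn]].
  by exists [:: 1] => w _; rewrite leqn0 => /nilP ->; rewrite big_nil inE.
exists (1 :: [seq x * y | x <- S', y <- s]) => -[|x w] /=.
  by rewrite big_nil inE eqxx.
case/andP=> xS wS wn; rewrite big_cons inE; apply/orP; right.
apply/allpairsP; exists (x, \prod_(j <- w) j); split=> //=; last exact: IHn.
rewrite mem_cat; case/orP: xS => [->//|xS]; apply/orP; right.
by apply/mapP; exists x^-1; rewrite ?invgK.
Qed.

(* Read [P n g] as: [g] has size at most [n]. *)
Lemma word_length_dominates (P : nat -> G -> Prop) :
  P 0%N 1 -> (forall m n g h, P m g -> P n h -> P (m + n)%N (g * h)) ->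
  (forall m n g, (m <= n)%N -> P m g -> P n g) ->
  (forall g, exists n, P n g) ->
  exists K, forall g, P (K * wl g)%N g.
Proof.
move=> P1 PM Pmono exP; pose S' := S ++ [seq x^-1 | x <- S].
have [K KS] : exists K, forall s, s \in S' -> P K s.
  elim: (S') => [|x s [K IHs]]; first by exists 0%N.
  have [n Pn] := exP x; exists (n + K)%N => y; rewrite inE => /orP[/eqP->|/IHs].
    by apply: Pmono Pn; exact: leq_addr.
  by apply: Pmono; exact: leq_addl.
exists K => g; have [w [wS <- <-]] := wlP g.
elim: w wS => [_|x w IHw /= /andP[xS wS]]; first by rewrite big_nil muln0.
rewrite big_cons mulnS; apply: PM; last exact: IHw.
apply: KS; rewrite mem_cat; case/orP: xS => [->//|xS]; apply/orP; right.
by apply/mapP; exists x^-1; rewrite ?invgK.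
Qed.

(** Serves to compare word lengths in different groups, and to bound supports and weights, without
    fixing explicit generators. *)
Lemma word_length_lipschitz (L : G -> nat) :
  L 1 = 0%N -> (forall g h, (L (g * h)%g <= L g + L h)%N) ->
  exists K, forall g, (L g <= K * wl g)%N.
Proof.
move=> L1 LM; apply: (@word_length_dominates (fun n g => (L g <= n)%N)).
- by rewrite L1.
- by move=> m n g h gm hn; rewrite (leq_trans (LM _ _)) // leq_add.
- by move=> m n g mn /leq_trans; apply.
- by move=> g; exists (L g).
Qed.

(** By finiteness of balls only finitely many pairs occur, so the supremum defining [CLF] is a
    genuine maximum. *)
Lemma conjugator_bound n : exists N, forall u v, (wl u + wl v <= n)%N ->
  conjugate u v ->
  (infimum 0%N [set wl w | w in [set w | (w * u = v * w)%g]] <= N)%N.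
Proof.
have [s sP] := finite_ball n.
pose F (p : G * G) : nat := infimum 0%N [set wl w | w in [set w | w * p.1 = p.2 * w]].
exists (\max_(p <- [seq (x, y) | x <- s, y <- s]) F p) => u v uv _.
have: (u, v) \in [seq (x, y) | x <- s, y <- s].
  by apply/allpairsP; exists (u, v); split=> //=; apply: sP; lia.
by move=> uvs; exact: (@leq_bigmax_seq _ _ xpredT F (u, v) uvs isT).
Qed.

Lemma CLF_le n N :
  (forall u v, (wl u + wl v <= n)%N -> conjugate u v ->
     exists2 w, w * u = v * w & (wl w <= N)%N) -> (CLF S n <= N)%N.
Proof.
move=> wN; apply: supremum_nat_le => k [u [v [uvn /(wN _ _ uvn)[w wuv le_wN] ->]]].
by apply: leq_trans le_wN; apply: infimum_nat_le; exists w.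
Qed.

(** Every lower bound goes through this: a size forced on all conjugators is forced on the one
    obtained here. *)
Lemma CLF_conjugator u v n : (wl u + wl v <= n)%N -> conjugate u v ->
  exists2 w, w * u = v * w & (wl w <= CLF S n)%N.
Proof.
move=> uvn uv; set E := [set wl w | w in [set w | w * u = v * w]].
have [|[w wuv wE] _] := @infimum_natP E; first by case: uv => w wuv; exists (wl w); exists w.
exists w => //; rewrite wE; have [N NP] := conjugator_bound n.
apply: (@supremum_nat_ge _ N); last by exists u, v; split.
by move=> k [u' [v' [le_n cj ->]]]; exact: NP.
Qed.

Lemma CLF_mono m n : (m <= n)%N -> (CLF S m <= CLF S n)%N.
Proof.
move=> mn; apply: CLF_le => u v uvm; apply: CLF_conjugator.
exact: leq_trans mn.
Qed.

End Gen.
End WordLength.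

(** * Lower bounds *)

Section WreathElements.
Variables A B : groupType.
Implicit Types (a : A) (b x y : B) (f g h : {fsfun B -> A with 1}).
Implicit Types (p q u v w : wreath A B).

Definition base f : wreath A B := (f, 1).
Definition top b : wreath A B := (fsfun_one A B, b).
Definition lamp x a : {fsfun B -> A with 1} := [fsfun fsfun_one A B with x |-> a].

Lemma lampE x a y : lamp x a y = if y == x then a else 1.
Proof. by rewrite fsfun_withE fsfun_oneE. Qed.

Lemma wreath_mulE p q x : (p * q).1 x = p.1 x * q.1 (p.2^-1 * x).
Proof. by rewrite fsfun_mulE fsfun_shiftE. Qed.

Lemma wreath_mul2 p q : (p * q).2 = p.2 * q.2. Proof. by []. Qed.

Lemma wreath_invE p x : p^-1.1 x = (p.1 (p.2 * x))^-1.
Proof. by rewrite fsfun_shiftE fsfun_invE invgK. Qed.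

Lemma wreath_inv2 p : p^-1.2 = p.2^-1. Proof. by []. Qed.

Lemma wreath_oneE x : (1 : wreath A B).1 x = 1.
Proof. exact: fsfun_oneE. Qed.

Lemma wreathP p q : p.1 =1 q.1 -> p.2 = q.2 -> p = q.
Proof. by case: p q => [f b] [g c] /= /fsfunP-> ->. Qed.

Lemma topE b x : (top b).1 x = 1. Proof. exact: fsfun_oneE. Qed.

Lemma topM b c : top (b * c) = top b * top c.
Proof.
by apply: wreathP => // x; rewrite wreath_mulE !topE mulg1.
Qed.

Lemma top1 : top 1 = 1. Proof. by []. Qed.

Lemma topV b : top b^-1 = (top b)^-1.
Proof. by apply: (mulgI (top b)); rewrite -topM !mulgV. Qed.

Lemma topX b n : top (b ^+ n) = top b ^+ n.
Proof. by elim: n => [|n IHn]; rewrite ?expg0 // !expgS topM IHn. Qed.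

Lemma baseM f g : base (fsfun_mul f g) = base f * base g.
Proof.
apply: wreathP => [x|]; last by rewrite wreath_mul2 mulg1.
by rewrite wreath_mulE /= fsfun_mulE invg1 mul1g.
Qed.

Lemma base_top p : p = base p.1 * top p.2.
Proof.
apply: wreathP => [x|]; last by rewrite wreath_mul2 /= mul1g.
by rewrite wreath_mulE topE mulg1.
Qed.

Lemma top_base_conj b f : top b * base f * top b^-1 = base (fsfun_shift b f).
Proof.
apply: wreathP => [x|]; last by rewrite !wreath_mul2 /= mulg1 mulgV.
by rewrite !wreath_mulE !topE mulg1 mul1g fsfun_shiftE.
Qed.

Lemma base_lamp x a : base (lamp x a) = top x * base (lamp 1 a) * top x^-1.
Proof.
rewrite top_base_conj; congr base; apply/fsfunP => y.
rewrite fsfun_shiftE !lampE; congr (if _ then _ else _).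
by apply/eqP/eqP => [->|/(congr1 ( *%g x))]; rewrite ?mulVg // mulVKg mulg1.
Qed.

Lemma lampM a a' : base (lamp 1 (a * a')) = base (lamp 1 a) * base (lamp 1 a').
Proof.
rewrite -baseM; congr base; apply/fsfunP => y.
by rewrite fsfun_mulE !lampE; case: eqP; rewrite ?mulg1.
Qed.

(** Alternating [e] with a step by [b] lays down translates of [e] along powers of [b], by a word of
    length linear in [n]. *)
Lemma iter_translateE (e : wreath A B) b n x : e.2 = 1 ->
  ((e * top b) ^+ n).1 x = \prod_(i < n) e.1 (b ^- i * x)
  /\ ((e * top b) ^+ n).2 = b ^+ n.
Proof.
move=> e2; elim: n x => [|n IHn] x; first by rewrite big_ord0 wreath_oneE.
have [IH1 IH2] := IHn x; rewrite expgSr wreath_mul2 IH2 wreath_mul2 e2 mul1g (expgSr b).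
split=> //; rewrite wreath_mulE IH1 IH2 big_ord_recr.
by rewrite (wreath_mulE e) topE mulg1.
Qed.

Lemma card_finsupp_ge f (s : seq B) : uniq s -> (forall x, x \in s -> f x != 1) ->
  (size s <= #|` finsupp f|)%N.
Proof.
move=> s_uniq sf; apply: uniq_leq_size => // x /sf.
by rewrite mem_finsupp.
Qed.

(** A nontrivial value repeated along infinitely many points contradicts finite support. *)
Lemma fsfun_trivial_on_orbit f (s : nat -> B) :
  injective s -> (forall i, f (s i) = f (s 0%N)) -> f (s 0%N) = 1.
Proof.
move=> s_inj fs; apply/eqP; apply/negPn/negP => fs0.
suff : (size (mkseq s #|` finsupp f|.+1) <= #|` finsupp f|)%N.
  by rewrite size_mkseq ltnn.
apply: card_finsupp_ge; first by rewrite map_inj_uniq // iota_uniq.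
by move=> x /mapP[i _ ->]; rewrite fs.
Qed.

Lemma infinite_order_inj b : infinite_order b -> injective (fun i => b ^+ i).
Proof.
move=> b_inf i j; wlog lt_ij : i j / (i < j)%N.
  move=> main eij; case: (ltngtP i j) => // [ij|ji]; first exact: main.
  by apply/esym; apply: main.
rewrite -(subnKC (ltnW lt_ij)) expgnDr -{1}[b ^+ i]mulg1 => /mulgI/esym/eqP.
by move: (b_inf (j - i)%N); rewrite subn_gt0 lt_ij => /(_ isT)/negPf->.
Qed.

End WreathElements.

(** * The grid lower bound *)

Section CLFLowerBound.
Variables (A B : groupType) (S : seq (wreath A B)).
Hypothesis genS : generated S = setT.
Local Notation wl := (word_length S).
Implicit Types (p q x : B).

(** The support of a product lies in the union of one support and a translate of the other. *)
Let card_supp_lipschitz : exists K, forall w : wreath A B,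
  (#|` finsupp w.1| <= K * wl w)%N.
Proof.
apply: word_length_lipschitz => //.
  by apply/eqP; rewrite cardfs_eq0; apply/eqP/fsetP=> x; rewrite mem_finsupp fsfun_oneE eqxx.
move=> v w; rewrite -(size_map (fun x => v.2 * x) (finsupp w.1)).
rewrite -size_cat; apply: uniq_leq_size => // x.
rewrite mem_finsupp wreath_mulE mem_cat => vwx; apply/orP.
case: (finsuppP v.1 x) vwx => [_|xv]; [right|by left].
rewrite mul1g in vwx; apply/mapP; exists (v.2^-1 * x); rewrite ?mulVKg //.
by rewrite mem_finsupp.
Qed.

(** Here the finite set of the grid argument is [q ^ j] for [j < n]. The constant precedes [p], [q],
    [m], [n], so that these may vary with the length considered. *)
Lemma CLF_grid (a : A) : a != 1 -> exists K, forall p q m n,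
  infinite_order p ->
  {in [seq (i, j) | i <- iota 0 m, j <- iota 0 n] &,
     injective (fun ij : nat * nat => p ^+ ij.1 * q ^+ ij.2)} ->
  (m * n <= K * CLF S (K * (n * (1 + wl (top A q)) + wl (top A (p ^+ m))
                                 + wl (top A p)))%N)%N.
Proof.
move=> a1; have [K1 suppK] := card_supp_lipschitz.
(* [K2] absorbs two rows, each costing [n] copies of [e] and [2 n] moves by [q]. *)
pose e := base (lamp (1 : B) a); pose K2 := (2 * wl e + 4)%N.
exists (K1 + K2)%N => p q m n p_inf pq_inj.
(* [row] lights the points [q ^ j] and returns to the origin; [H] repeats it along [p]. The count
   [c] keeps multiplicities, so that distinctness of the grid points enters only at the end. *)
pose row := (e * top A q) ^+ n * top A (q ^- n).
pose H := (row * top A p) ^+ m * top A (p ^- m).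
pose c x := (\sum_(j < n) (q ^- j * x == 1)%g)%N.
have row2 : row.2 = 1.
  by rewrite wreath_mul2 (proj2 (iter_translateE q n 1 _)) // mulgV.
have rowE x : row.1 x = a ^+ c x.
  rewrite wreath_mulE topE mulg1 (proj1 (iter_translateE q n x _)) // /c -prodgXr.
  by apply: eq_bigr => j _; rewrite lampE expgb.
have wl_row : (wl row <= n * (wl e + 2 * wl (top A q)))%N.
  have -> : (n * (wl e + 2 * wl (top A q)) = n * (wl e + wl (top A q)) + n * wl (top A q))%N.
    by rewrite -mulnDr; congr (_ * _)%N; lia.
  apply: word_lengthM_le => //; first exact: word_lengthX_le (word_lengthM genS _ _).
  by rewrite topV topX; apply: word_lengthV_le => //; exact: word_lengthX_le.
clearbody row.
have H2 : H.2 = 1.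
  by rewrite wreath_mul2 (proj2 (iter_translateE p m 1 _)) // mulgV.
have HE x : H.1 x = a ^+ (\sum_(i < m) c (p ^- i * x)%g)%N.
  rewrite wreath_mulE topE mulg1 (proj1 (iter_translateE p m x _)) // -prodgXr.
  by apply: eq_bigr => j _; rewrite rowE.
clearbody H.
(* This is [H^-1 p H] after telescoping: [H] and its translate by [p] differ only in the rows
   numbered 0 and [m]. *)
pose u := row^-1 * (top A (p ^+ m) * row * top A (p ^- m)) * top A p.
have Hu : H * u = top A p * H.
  apply: wreathP => [x|]; last first.
    by rewrite !wreath_mul2 wreath_inv2 row2 H2 /= invg1 !mul1g !mulg1 mulgV mul1g.
  rewrite !(wreath_mulE, topE, wreath_invE, wreath_mul2, wreath_inv2) H2 row2.
  rewrite /= !(invg1, mul1g, mulg1) !HE !rowE.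
  set s1 := (\sum_(i < m) _)%N; set s2 := (\sum_(i < m) _)%N.
  (* Both sides are the sum over [i <= m], with the last or the first term split off. *)
  have es : (s1 + c (p ^- m * x)%g = c x + s2)%N.
    rewrite /s1 -(big_ord_recr m (fun i : 'I_m.+1 => c (p ^- i * x)%g)) /=.
    rewrite big_ord_recl expg0 invg1 mul1g; congr (_ + _)%N.
    apply: eq_bigr => i _; congr c.
    by rewrite lift0 expgS invgM mulgA.
  apply: (mulgI (a ^+ c x)); rewrite -expgnDr -es expgnDr !mulgA; congr (_ * _).
  by rewrite -expgnDr addnC expgnDr mulgK.
have wl_u : (wl u <= 2 * wl row + 2 * wl (top A (p ^+ m)) + wl (top A p))%N.
  have -> : (2 * wl row + 2 * wl (top A (p ^+ m)) + wl (top A p) =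
      wl row + (wl (top A (p ^+ m)) + wl row + wl (top A (p ^+ m))) + wl (top A p))%N by lia.
  do ![apply: word_lengthM_le => //]; first exact: word_lengthV_le.
  by rewrite topV; exact: word_lengthV_le.
have wl_uv : (wl u + wl (top A p) <= (K1 + K2) * (n * (1 + wl (top A q))
    + wl (top A (p ^+ m)) + wl (top A p)))%N.
  move: wl_u wl_row; rewrite /K2; nia.
suff mn_le (w : wreath A B) : w * u = top A p * w -> (m * n <= K1 * wl w)%N.
  case: (posnP K1) => [K10|K1_gt0].
    have := mn_le H Hu; rewrite K10 mul0n leqn0 => /eqP->; exact: leq0n.
  apply: (@leq_trans (K1 * CLF S ((K1 + K2) * (n * (1 + wl (top A q))
    + wl (top A (p ^+ m)) + wl (top A p))))%N); last by rewrite leq_mul2r leq_addr orbT.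
  have [w wu wlw] := CLF_conjugator genS wl_uv (ex_intro _ H Hu).
  by rewrite (leq_trans (mn_le w wu)) // leq_mul2l wlw orbT.
move=> wu; apply: leq_trans (suppK w).
(* [C] centralizes [p], so its lamps are constant along [<p>]-orbits and hence trivial; thus the
   lamps of [w] are a translate of those of [H]. *)
pose C := w * H^-1.
have uE : u = H^-1 * (top A p * H) by rewrite -Hu mulKg.
have Ccomm : C * top A p = top A p * C.
  apply: (mulIg H); rewrite /C -!mulgA mulVg mulg1 -wu uE !mulgA.
  by [].
have wC : w = C * H by rewrite /C mulgVK.
clearbody C.
have C1 x : C.1 x = 1.
  have Cp y : C.1 (p^-1 * y) = C.1 y.
    have : (C * top A p).1 y = (top A p * C).1 y by rewrite Ccomm.
    by rewrite !wreath_mulE !topE mul1g mulg1.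
  have := @fsfun_trivial_on_orbit A B C.1 (fun i => p ^+ i * x).
  rewrite expg0 mul1g; apply=> [i j /mulIg/(infinite_order_inj p_inf)//|i].
  by elim: i => [|i IHi]; rewrite ?expg0 ?mul1g // -[LHS]Cp expgS -mulgA mulKg.
have wE x : w.1 x = H.1 (C.2^-1 * x).
  by rewrite wC wreath_mulE C1 mul1g.
set s := [seq (i, j) | i <- iota 0 m, j <- iota 0 n] in pq_inj.
have s_uniq : uniq s by apply: allpairs_uniq; rewrite ?iota_uniq // => -[? ?] [? ?].
have <- : size [seq C.2 * (p ^+ ij.1 * q ^+ ij.2) | ij <- s] = (m * n)%N.
  by rewrite size_map size_allpairs !size_iota.
apply: card_finsupp_ge.
  by rewrite map_inj_in_uniq // => ij kl ijs kls /mulgI; apply: pq_inj.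
move=> x /mapP[[i j] ijs ->{x}]; rewrite wE mulKg HE /=.
have [im jn] : (i < m)%N /\ (j < n)%N.
  have /allpairsP[[k l] /= [km ln [-> ->]]] := ijs.
  by move: km ln; rewrite !mem_iota !add0n.
(* By injectivity each grid point is lit exactly once, so its lamp is [a] itself and not a power
   that might be trivial. *)
suff -> : (\sum_(k < m) c (p ^- k * (p ^+ i * q ^+ j))%g = 1)%N by [].
rewrite (bigD1 (Ordinal im)) //= mulKg big1 ?addn0.
  rewrite /c (bigD1 (Ordinal jn)) //= mulVg eqxx big1 // => l lj.
  apply/eqP; rewrite eqb0; apply: contra lj => /eqP.
  rewrite -[1](mulVg (q ^+ l)) => /mulgI el.
  have ils : (i, nat_of_ord l) \in s.
    by apply/allpairsP; exists (i, nat_of_ord l); rewrite /= !mem_iota !add0n ltn_ord im.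
  have [jl] := pq_inj _ _ ijs ils (congr1 ( *%g (p ^+ i)) el).
  by apply/eqP/val_inj.
move=> k ki; rewrite /c big1 // => l _.
apply/eqP; rewrite eqb0; apply: contra ki => /eqP.
rewrite -[1](mulVg (q ^+ l)) => /mulgI.
rewrite -[X in _ = X](mulKg (p ^+ k)) => /mulgI el.
have kls : (nat_of_ord k, nat_of_ord l) \in s.
  apply/allpairsP; exists (nat_of_ord k, nat_of_ord l).
  by rewrite /= !mem_iota !add0n !ltn_ord.
have [ik _] := pq_inj _ _ ijs kls el.
by apply/eqP/val_inj.
Qed.

End CLFLowerBound.

(** * Total length of the lamp values *)

Section Weight.
Variables (A B : groupType) (SA : seq A).
Hypothesis genSA : generated SA = setT.
Implicit Types (f g : {fsfun B -> A with 1}) (b x : B).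

Definition weight f := (\sum_(x <- finsupp f) word_length SA (f x))%N.

Lemma weight_incl f (D : {fset B}) : (finsupp f `<=` D)%fset ->
  weight f = (\sum_(x <- D) word_length SA (f x))%N.
Proof.
move=> fD; apply: big_fset_incl => // x _.
by rewrite memNfinsupp => /eqP->; rewrite word_length1.
Qed.

Lemma weightM f g : (weight (fsfun_mul f g) <= weight f + weight g)%N.
Proof.
pose D := (finsupp f `|` finsupp g)%fset.
rewrite !(@weight_incl _ D) ?fsubsetUl ?fsubsetUr //.
  rewrite -big_split /= leq_sum // => x _.
  by rewrite fsfun_mulE; exact: word_lengthM.
apply/fsubsetP => x; rewrite in_fsetU !mem_finsupp fsfun_mulE -negb_and.
by apply: contra => /andP[/eqP-> /eqP->]; rewrite mulg1.
Qed.

Lemma weight_shift b f : weight (fsfun_shift b f) = weight f.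
Proof.
rewrite (@weight_incl _ [fset b * y | y in finsupp f]%fset).
  rewrite big_imfset /=; last by move=> x y _ _; exact: mulgI.
  by apply: eq_bigr => x _; rewrite fsfun_shiftE mulKg.
apply/fsubsetP => x; rewrite mem_finsupp fsfun_shiftE => fx.
by apply/imfsetP; exists (b^-1 * x); rewrite ?mem_finsupp // mulVKg.
Qed.

Lemma weight1 : weight (fsfun_one A B) = 0%N.
Proof. by rewrite /weight big1 // => x _; rewrite fsfun_oneE word_length1. Qed.

Lemma weight_le f x : (word_length SA (f x) <= weight f)%N.
Proof.
case: (finsuppP f x) => [_|xf]; first by rewrite word_length1.
by rewrite /weight (big_fsetD1 x) //= leq_addr.
Qed.

Lemma weight_without f x :
  weight f = (word_length SA (f x) + weight [fsfun f without x])%N.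
Proof.
case: (finsuppP f x) => [xf|xf]; last first.
  rewrite /weight (big_fsetD1 x) //= (finsupp_without f x x); congr (_ + _)%N.
  rewrite !big_seq; apply: eq_bigr => y; rewrite in_fsetD1 => /andP[yx _].
  by rewrite fsfun_withE (negPf yx).
rewrite word_length1; congr weight; apply/fsfunP=> y; rewrite fsfun_withE.
by case: eqP => // ->; rewrite fsfun_dflt.
Qed.

End Weight.

(** * Lower bounds from distortion, from planar grids and from the lamp group *)

Section CLFLowerBounds.
Variables (A B : groupType) (S : seq (wreath A B)).
Hypothesis genS : generated S = setT.
Hypothesis A_nontrivial : exists a : A, a != 1.
Local Notation wl := (word_length S).

Lemma cyclicP (x h : B) : generated [:: x] h -> exists m, h = x ^+ m \/ h = x ^- m.
Proof.
pose M : set B := [set k | exists m, k = x ^+ m \/ k = x ^- m].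
move=> xh; apply: (smallest_sub (X := M)) xh => [|k]; last first.
  by rewrite /= inE => /eqP->; exists 1%N; left; rewrite expg1.
split; first by exists 0%N; left.
have XV i j : M (x ^+ i * x ^- j).
  case: (leqP j i) => [ji|/ltnW ij]; first by exists (i - j)%N; left; rewrite expgnFr.
  by exists (j - i)%N; right; rewrite expgnFr // invgF.
have XV' i j : M (x ^- i * x ^+ j).
  have -> : x ^- i * x ^+ j = x ^+ j * x ^- i; last exact: XV.
  by apply/esym/commuteV/esym/commuteX2.
move=> _ _ [i [->|->]] [j [->|->]] //.
- by rewrite invgK -expgnDr; exists (i + j)%N; left.
- by rewrite -invgM -expgnDr; exists (j + i)%N; right.
- by rewrite invgK.
Qed.

Lemma CLF_distortion (x : B) (T X : seq B) : infinite_order x ->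
  generated T = setT -> generated X = generated [:: x] ->
  exists K, forall n, (distortion T X n <= K * CLF S (K * n))%N.
Proof.
move=> x_inf genT genX; have [a a1] := A_nontrivial.
have [K gridK] := CLF_grid genS a1.
have [KT topK] : exists K, forall b : B, (wl (top A b) <= K * word_length T b)%N.
  apply: (word_length_lipschitz genT (L := fun b => wl (top A b))).
    by rewrite top1 word_length1.
  by move=> b c; rewrite topM; exact: word_lengthM.
(* The first term pays for passing from [m] to the length of [x ^ m] over [X]; the second absorbs
   the argument of [CLF] in the grid bound. *)
pose k := (word_length X x * K + K * (1 + KT + wl (top A x)))%N.
exists k => n; apply: supremum_nat_le => _ [h [hX hn] <-].
(* The additive constants of the grid bound can be absorbed only at positive length. *)
case: n hn => [|n] hn.
  have -> : h = 1 by apply: (word_length_eq0 genT); apply/eqP; rewrite -leqn0.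
  by rewrite word_length1.
have xX : generated X x by rewrite genX; apply: generated_mem; rewrite inE.
have [m hm] : exists m, word_length X h = word_length X (x ^+ m) /\
    word_length T h = word_length T (x ^+ m).
  have [m [->|->]] : exists m, h = x ^+ m \/ h = x ^- m by apply: cyclicP; rewrite -genX.
    by exists m.
  by exists m; rewrite word_lengthV_in ?(word_lengthV genT) //; exact: generatedX.
case: hm => -> hT; rewrite hT in hn.
apply: leq_trans (word_lengthX_in m xX) _.
(* The grid is a single column: [q = 1] and one point per row. *)
have := gridK x 1 m 1%N x_inf; rewrite muln1 top1 word_length1 => le_m.
have {}le_m : (m <= K * CLF S (k * n.+1))%N.
  apply: (leq_trans (le_m _)).
    move=> _ _ /allpairsP[[i i'] [_ i'0 ->]] /allpairsP[[j j'] [_ j'0 ->]].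
    move: i'0 j'0; rewrite /= !inE => /eqP-> /eqP-> /=.
    by rewrite !mulg1 => /(infinite_order_inj x_inf)->.
  rewrite leq_mul2l; apply/orP; right; apply: CLF_mono => //.
  have := topK (x ^+ m); have := leq_mul (leqnn KT) hn; rewrite /k; nia.
rewrite [k]lock in le_m *.
apply: (@leq_trans (word_length X x * K * CLF S (locked k * n.+1))%N).
  by rewrite mulnC -mulnA leq_mul2l le_m orbT.
by rewrite leq_mul2r; apply/orP; right; rewrite -lock leq_addr.
Qed.

(** The points [p ^ i * q ^ j] with [i, j < n] form a grid of [n ^ 2] distinct points, and every
    length in the grid bound is linear in [n]. *)
Lemma CLF_square (p q : B) :
  (forall i j k l, p ^+ i * q ^+ j = p ^+ k * q ^+ l -> i = k /\ j = l) ->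
  exists K, forall n, (n ^ 2 <= K * CLF S (K * n))%N.
Proof.
move=> pq_inj; have [a a1] := A_nontrivial; have [K gridK] := CLF_grid genS a1.
have p_inf : infinite_order p.
  move=> n n_gt0; apply/eqP => pn; have := pq_inj n 0%N 0%N 0%N.
  by rewrite pn !expg0 => /(_ erefl)[n0]; rewrite n0 in n_gt0.
pose k := (K * (1 + (1 + wl (top A q) + wl (top A p) + wl (top A p))))%N.
exists k => -[//|n].
have /gridK : {in [seq (i, j) | i <- iota 0 n.+1, j <- iota 0 n.+1] &,
    injective (fun ij : nat * nat => p ^+ ij.1 * q ^+ ij.2)}.
  by move=> [i j] [i' j'] _ _ /= /pq_inj[-> ->].
move=> /(_ p_inf); rewrite mulnn => /leq_trans; apply; apply: leq_mul.
  by rewrite /k; nia.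
apply: CLF_mono => //; have := word_lengthX genS (top A p) n.+1.
rewrite -topX /k => pn; nia.
Qed.

Lemma wl_lamp_lipschitz (SA : seq A) : generated SA = setT ->
  exists K, forall a : A, (wl (base (lamp (1 : B) a)) <= K * word_length SA a)%N.
Proof.
move=> genSA.
apply: (word_length_lipschitz genSA (L := fun a => wl (base (lamp (1 : B) a)))).
  suff -> : base (lamp (1 : B) (1 : A)) = 1 by rewrite word_length1.
  by apply: wreathP => // x; rewrite lampE wreath_oneE if_same.
by move=> a a'; rewrite lampM; exact: word_lengthM.
Qed.

(** Place [a] and [a'] as lamps at the identity. If [a] is nontrivial, a conjugator has trivial
    cursor, and its own lamp at the identity conjugates [a] to [a']. *)
Lemma CLF_lamp_group (SA : seq A) : generated SA = setT ->
  exists K, forall n, (CLF SA n <= K * CLF S (K * n))%N.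
Proof.
move=> genSA.
have [K1 baseK] := wl_lamp_lipschitz genSA.
have [K2 weightK] : exists K, forall w : wreath A B, (weight SA w.1 <= K * wl w)%N.
  apply: (word_length_lipschitz genS (L := fun w => weight SA w.1)).
    by rewrite weight1.
  move=> v w; apply: leq_trans (weightM genSA _ _) _.
  by rewrite leq_add2l weight_shift.
exists (K1 + K2)%N => n.
apply: (@leq_trans (K2 * CLF S (K1 * n))); last first.
  by rewrite leq_mul ?leq_addl // CLF_mono // leq_mul2r leq_addr orbT.
apply: CLF_le => a a' aa' [c ca].
case: (eqVneq a 1) => [a1|a1].
  exists 1; last by rewrite word_length1.
  have -> : a' = 1 by apply: (mulIg c); rewrite -ca a1 mulg1 mul1g.
  by rewrite a1.
have cj : conjugate (base (lamp (1 : B) a)) (base (lamp 1 a')).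
  by exists (base (lamp 1 c)); rewrite -!lampM ca.
have uv : (wl (base (lamp (1 : B) a)) + wl (base (lamp (1 : B) a')) <= K1 * n)%N.
  apply: leq_trans (leq_add (baseK _) (baseK _)) _.
  by rewrite -mulnDr leq_mul2l aa' orbT.
have [w wu wlw] := CLF_conjugator genS uv cj.
have wE x : w.1 x * lamp 1 a (w.2^-1 * x) = lamp 1 a' x * w.1 x.
  have : (w * base (lamp 1 a)).1 x = (base (lamp 1 a') * w).1 x by rewrite wu.
  by rewrite !wreath_mulE /= invg1 mul1g.
exists (w.1 1); last first.
  apply: leq_trans (weight_le SA w.1 1) _; apply: leq_trans (weightK w) _.
  by rewrite leq_mul2l wlw orbT.
(* At [w.2] the left lamp is [a]; a nontrivial [w.2] would make the right one trivial and force
   [a = 1]. *)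
have := wE w.2; rewrite mulVg !lampE eqxx.
case: (eqVneq w.2 1) => [->//|_]; rewrite mul1g -[RHS]mulg1 => /mulgI/eqP.
by rewrite (negPf a1).
Qed.

End CLFLowerBounds.

(** * Upper bound over an abelian base *)

Section SupportInduction.
Variables A B : groupType.
Implicit Types (f : {fsfun B -> A with 1}) (d x : B).

Lemma base_without f d :
  base f = base [fsfun f without d] * base (lamp d (f d)).
Proof.
rewrite -baseM; congr base; apply/fsfunP => x.
by rewrite fsfun_mulE fsfun_withE lampE; case: eqP => [->|]; rewrite ?mul1g ?mulg1.
Qed.

(** Peeling off a lamp of least level ensures, in [sweep_exists], that whatever is laid strictly
    below it meets no other lamp of [f]. *)
Lemma fsfun_ind_min (l : B -> int) (P : {fsfun B -> A with 1} -> Prop) :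
  P (fsfun_one A B) ->
  (forall f d, f d != 1 -> (forall x, f x != 1 -> (l d <= l x)%R) ->
     P [fsfun f without d] -> P f) ->
  forall f, P f.
Proof.
move=> P1 Pstep f; have [n] := ubnP #|` finsupp f|; elim: n f => // n IHn f fn.
have min_exists (s : seq B) : s != [::] ->
    exists2 d, d \in s & forall x, x \in s -> (l d <= l x)%R.
  elim: s => // y [|z s] IHs _; first by exists y; rewrite ?inE // => x; rewrite inE => /eqP->.
  have [//|d ds dmin] := IHs; case: (leP (l y) (l d)) => yd.
    exists y; rewrite ?inE ?eqxx // => x; rewrite inE => /orP[/eqP->//|/dmin].
    exact: le_trans.
  exists d; first by rewrite inE ds orbT.
  by move=> x; rewrite inE => /orP[/eqP->|/dmin//]; exact: ltW.
case: (eqVneq (finsupp f) fset0) => [f0|f0].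
  suff -> : f = fsfun_one A B by [].
  apply/fsfunP => x; rewrite fsfun_oneE; apply/eqP.
  by rewrite -memNfinsupp f0 in_fset0.
have [|d df dmin] := min_exists (finsupp f); first by rewrite -nilpE /nilp cardfs_eq0.
apply: (Pstep f d); first by rewrite -mem_finsupp.
  by move=> x fx; apply: dmin; rewrite mem_finsupp.
apply: IHn; rewrite (finsupp_without f d d).
by move: fn; rewrite (cardfsD1 d) df add1n ltnS.
Qed.

End SupportInduction.

Section CLFUpperBound.
Variables (A B : groupType) (SA : seq A) (S : seq (wreath A B)).
Hypothesis genSA : generated SA = setT.
Hypothesis genS : generated S = setT.
Hypothesis mulBC : forall x y : B, x * y = y * x.
Variables (norm : B -> nat) (R K : nat).
Hypothesis norm1 : norm 1 = 0%N.
Hypothesis normM : forall x y : B, (norm (x * y)%g <= norm x + norm y)%N.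
Hypothesis normV : forall x : B, norm x^-1 = norm x.
(** A height along [<b>]: since [l b] is comparable to the norm of [b], crossing a range of levels
    by steps of [b] costs only a multiple of that range. *)
Hypothesis level_exists : forall b : B, b != 1 -> exists l : B -> int,
  [/\ forall x y : B, l (x * y) = (l x + l y)%R,
      forall x, (`|l x| <= norm x)%N, (0 < l b)%R & (norm b <= R * `|l b|)%N].
Local Notation wl := (word_length S).
Local Notation wlA := (word_length SA).
Hypothesis wl_top : forall x : B, (wl (top A x) <= K * norm x)%N.
Hypothesis wl_lamp1 : forall a : A, (wl (base (lamp (1 : B) a)) <= K * wlA a)%N.
Implicit Types (b d x y : B) (a : A) (f g h : {fsfun B -> A with 1}).
Implicit Types (u v w : wreath A B).

Lemma wl_lamp x a : (wl (base (lamp x a)) <= K * (2 * norm x + wlA a))%N.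
Proof.
rewrite base_lamp topV.
have -> : (K * (2 * norm x + wlA a) = K * norm x + K * wlA a + K * norm x)%N by lia.
do ![apply: word_lengthM_le => //].
exact: word_lengthV_le.
Qed.

Lemma card_finsupp_weight f : (#|` finsupp f| <= weight SA f)%N.
Proof.
rewrite card_fset_sum1 /weight !big_seq leq_sum // => x.
by rewrite mem_finsupp; exact: word_length_gt0.
Qed.

(** Each lamp is visited by its own round trip from the origin; this is good enough for quadratic
    bounds. *)
Lemma wl_base (M : nat) f : (forall x, f x != 1 -> (norm x <= M)%N) ->
  (wl (base f) <= K * (2 * M * #|` finsupp f| + weight SA f))%N.
Proof.
elim/(@fsfun_ind_min A B (fun=> 0%R)): f => [_|f d fd _ IHf fM].
  by rewrite (_ : base _ = 1) // word_length1.
have df : d \in finsupp f by rewrite mem_finsupp.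
rewrite (base_without f d) (weight_without SA f d) (cardfsD1 d) df -(finsupp_without f d d).
set f' := [fsfun f without d] in IHf *.
have -> : (K * (2 * M * (true + #|` finsupp f'|) + (wlA (f d) + weight SA f')) =
  K * (2 * M * #|` finsupp f'| + weight SA f') + K * (2 * M + wlA (f d)))%N by lia.
apply: word_lengthM_le => //.
  apply: IHf => x; rewrite fsfun_withE; case: (x =P d) => [_|_]; first by rewrite eqxx.
  exact: fM.
apply: leq_trans (wl_lamp _ _) _.
by rewrite leq_mul2l leq_add2r leq_mul2l fM // !orbT.
Qed.

(** * Pushing lamps along the cosets of a nontrivial cursor *)

Section Sweep.
Variables (b : B) (l : B -> int).
Hypothesis lM : forall x y : B, l (x * y) = (l x + l y)%R.
Hypothesis l_norm : forall x, (`|l x| <= norm x)%N.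
Hypothesis lb_gt0 : (0 < l b)%R.
Hypothesis norm_b : (norm b <= R * `|l b|)%N.

Lemma level1 : l 1 = 0%R.
Proof. by have := lM 1 1; rewrite mulg1; lia. Qed.

Lemma levelV x : l x^-1 = (- l x)%R.
Proof. by have := lM x x^-1; rewrite mulgV level1; lia. Qed.

Lemma levelX x n : l (x ^+ n) = (l x * n%:Z)%R.
Proof.
elim: n => [|n IHn]; first by rewrite expg0 level1 mulr0.
by rewrite expgS lM IHn; lia.
Qed.

Lemma level_infinite_order : infinite_order b.
Proof.
move=> n n_gt0; apply/eqP => /(congr1 l); rewrite levelX level1.
by nia.
Qed.

(* The value [a] is spread over the points of [d <b>] which lie strictly below
   [d] and have level at least [- M]. *)
Lemma segment_exists (M : nat) d a : (norm d <= M)%N ->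
  exists s : {fsfun B -> A with 1},
  [/\ forall x, s x != 1 -> (- M%:Z <= l x < l d)%R,
      forall x, (- M%:Z <= l (b^-1 * x)%g)%R -> s (b^-1 * x) = s x * lamp d a x
    & (wl (base s) <= K * M * (2 + 8 * R + 2 * wlA a))%N].
Proof.
(* [N] is the largest number of steps down from [d] by [b^-1] that stay at level at least [- M]. *)
move=> dM; pose N := `|(l d + M%:Z)%R|%N %/ `|l b|.
have ldM := l_norm d.
have [NM MN] : (l b * N%:Z <= l d + M%:Z)%R /\ (l d + M%:Z < l b * N.+1%:Z)%R.
  have := divn_eq `|(l d + M%:Z)%R|%N `|l b|; rewrite -/N.
  have : (`|(l d + M%:Z)%R|%N %% `|l b| < `|l b|)%N by rewrite ltn_mod; lia.
  set m := (_ %% _)%N => m_lt; split; nia.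
pose c := (b^-1 : B).
pose s := top A d * ((base (lamp c a) * top A c) ^+ N * top A (c ^- N)) * top A d^-1.
pose cnt x := (\sum_(k < N) (b ^+ k.+1 * x == d)%g)%N.
have s2 : s.2 = 1.
  by rewrite !wreath_mul2 (proj2 (iter_translateE c N 1 _)) //= mulgV mulg1 mulgV.
have sE x : s.1 x = a ^+ cnt x.
  rewrite !wreath_mulE !topE mulg1 mul1g (proj1 (iter_translateE c N _ _)) //.
  rewrite mulg1 -prodgXr; apply: eq_bigr => k _.
  rewrite lampE -expgb; congr (_ ^+ _); congr nat_of_bool.
  rewrite /c expVgn invgK mulgA (mulBC _ d^-1) -mulgA expgS -mulgA.
  apply/eqP/eqP => [kx|bkx]; first by rewrite -[d](mulgVK b) -kx mulBC mulVKg.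
  by rewrite -[_ * x](mulKg b) bkx (mulBC b^-1) mulKg.
have cnt_neq0 x : cnt x != 0%N -> exists2 k, (k < N)%N & b ^+ k.+1 * x = d.
  rewrite sum_nat_eq0 negb_forall => /existsP[k].
  by rewrite eqb0 negbK => /eqP kd; exists k.
have cntS x : (- M%:Z <= l (b^-1 * x)%g)%R ->
    cnt (b^-1 * x) = ((x == d) + cnt x)%N.
  rewrite lM levelV => lx.
  (* Otherwise [b^-1 * x] would be [N + 1] steps below [d], at a level under [- M]. So a vanishing
     term can be added to the count. *)
  have xN : (b ^+ N * x == d) = false.
    by apply/eqP => /(congr1 l); rewrite lM levelX; nia.
  rewrite -[LHS]addn0 -[0%N]/(nat_of_bool false) -xN.
  transitivity (\sum_(k < N.+1) (b ^+ k * x == d)%g)%N.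
    rewrite big_ord_recr /=; congr (_ + _)%N; apply: eq_bigr => k _.
    by rewrite expgSr -mulgA mulVKg.
  by rewrite big_ord_recl expg0 mul1g; congr (_ + _)%N; apply: eq_bigr.
exists s.1; split=> [x|x lx|].
- rewrite sE; case: (eqVneq (cnt x) 0%N) => [->|/cnt_neq0[k kN /(congr1 l)]].
    by rewrite expg0 eqxx.
  by rewrite lM levelX => kd _; nia.
- rewrite !sE cntS // lampE expgnDr expgb; case: eqP => _; rewrite ?mul1g ?mulg1 //.
  by rewrite -expgS expgSr.
have -> : base s.1 = s by rewrite [RHS]base_top s2 top1 mulg1.
(* The segment spans levels between [- M] and [M]; through [norm_b] this makes the travel
   [N * norm b] linear in [M]. *)
have N_le : (N * `|l b| <= 2 * M)%N by nia.
have wl_c : (wl (top A c) <= K * norm b)%N by rewrite -(normV b).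
apply: (@leq_trans (K * norm d + (N * (K * (2 * norm b + wlA a) + K * norm b)
    + N * (K * norm b)) + K * norm d)).
  do ![apply: word_lengthM_le => //]; last by rewrite -(normV d).
    apply: word_lengthX_le => //; apply: word_lengthM_le => //.
    by rewrite -(normV b); exact: wl_lamp.
  by rewrite topV topX; apply: word_lengthV_le => //; exact: word_lengthX_le.
have Nb : (N * norm b <= R * (2 * M))%N.
  apply: leq_trans (leq_mul (leqnn N) norm_b) _.
  by rewrite mulnCA leq_mul2l N_le orbT.
have Na : (N * wlA a <= 2 * M * wlA a)%N.
  by rewrite leq_mul2r; apply/orP; right; nia.
have -> : (K * norm d + (N * (K * (2 * norm b + wlA a) + K * norm b)
    + N * (K * norm b)) + K * norm d =
  K * (2 * norm d + 4 * (N * norm b) + N * wlA a))%N by ring.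
have -> : (K * M * (2 + 8 * R + 2 * wlA a) =
  K * (2 * M + 4 * (R * (2 * M)) + 2 * M * wlA a))%N by ring.
rewrite leq_mul2l; apply/orP; right; lia.
Qed.

(** The product of the segments of all lamps of [f] solves the difference equation above level
    [- M]. A nontrivial lamp has length at least 1, so the fixed cost of its segment is absorbed in
    its weight. *)
Lemma sweep_exists (M : nat) f : (forall x, f x != 1 -> (norm x <= M)%N) ->
  exists h : {fsfun B -> A with 1},
  [/\ forall x, (l x < - M%:Z)%R -> h x = 1,
      forall x, (- M%:Z <= l (b^-1 * x)%g)%R -> h (b^-1 * x) = h x * f x
    & (wl (base h) <= K * (4 + 8 * R) * M * weight SA f)%N].
Proof.
elim/(@fsfun_ind_min A B l): f => [_|f d fd dmin IHf fM].
  exists (fsfun_one A B); split=> [x _|x _|].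
  - by rewrite fsfun_oneE.
  - by rewrite !fsfun_oneE mulg1.
  - by rewrite (_ : base _ = 1) // word_length1.
have [|h [hM hf wlh]] := IHf.
  move=> x; rewrite fsfun_withE; case: (x =P d) => [_|_]; first by rewrite eqxx.
  exact: fM.
have [s [sM sd wls]] := segment_exists (f d) (fM d fd).
exists (fsfun_mul h s); split=> [x xM|x xM|].
- rewrite fsfun_mulE hM // mul1g; apply/eqP; apply/negPn/negP => /sM.
  by rewrite leNgt xM.
- rewrite !fsfun_mulE hf // sd // fsfun_withE lampE.
  case: eqP => [->|_]; first by rewrite mulg1 mulgA.
  (* [s x] and [f x] must be exchanged; by minimality of [d] one of them is trivial. *)
  rewrite mulg1 -!mulgA; congr (_ * _).
  case: (eqVneq (s x) 1) => [->|/sM/andP[_ xd]]; first by rewrite mulg1 mul1g.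
  case: (eqVneq (f x) 1) => [->|/dmin]; first by rewrite mulg1 mul1g.
  by rewrite leNgt xd.
rewrite baseM (weight_without SA f d) mulnDr addnC.
apply: word_lengthM_le => //; apply: leq_trans wls _.
have := word_length_gt0 genSA fd; set k := wlA (f d) => k_gt0.
have -> : (K * (4 + 8 * R) * M * k = K * M * ((4 + 8 * R) * k))%N by ring.
by rewrite leq_mul2l; apply/orP; right; nia.
Qed.

(** Once its cursor is fixed, [w] is determined by [u] and [v]: its lamps satisfy a difference
    equation along [<b>] whose only finitely supported solution is the quotient of two sweeps. *)
Lemma conjugator_length_le (M : nat) u v w : u.2 = b -> v.2 = b -> w * u = v * w ->
  (forall x, v.1 x != 1 -> (norm x <= M)%N) ->
  (forall x, u.1 x != 1 -> (norm (w.2 * x)%g <= M)%N) ->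
  (wl w <= K * (4 + 8 * R) * M * (weight SA u.1 + weight SA v.1) + K * norm w.2)%N.
Proof.
move=> u2 v2 wu vM uM; pose F := fsfun_shift w.2 u.1.
have FM x : F x != 1 -> (norm x <= M)%N.
  by rewrite fsfun_shiftE => /uM; rewrite mulVKg.
have wE x : w.1 x * F x = v.1 x * w.1 (b^-1 * x).
  have : (w * u).1 x = (v * w).1 x by rewrite wu.
  by rewrite !wreath_mulE v2 fsfun_shiftE.
have [hF [hF1 hFE wlF]] := sweep_exists FM.
have [hG [hG1 hGE wlG]] := sweep_exists vM.
(* The two sweep equations and that of [w] make [e] invariant under upward moves above level [- M],
   hence trivial there. Below, no lamp of [F] or [v] occurs and [w] is invariant under downward
   moves. *)
pose e := fsfun_mul (fsfun_mul hG w.1) (fsfun_inv hF).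
have eE x : e x = hG x * w.1 x * (hF x)^-1 by rewrite !fsfun_mulE fsfun_invE.
have e_above x : (- M%:Z <= l x)%R -> e x = 1.
  move=> xM; have := @fsfun_trivial_on_orbit A B e (fun i => b ^+ i * x).
  rewrite expg0 mul1g; apply=> [i j /mulIg/(infinite_order_inj level_infinite_order)//|i].
  elim: i => [|i <-]; first by rewrite expg0 mul1g.
  have bi : b ^+ i * x = b^-1 * (b ^+ i.+1 * x) by rewrite expgS -mulgA mulKg.
  have lbi : (- M%:Z <= l (b ^+ i * x)%g)%R by rewrite lM levelX; nia.
  rewrite bi in lbi *; set y := _ ^+ _ * x in lbi *.
  rewrite !eE hFE // hGE // invgM -(mulgA (hG y) (v.1 y)) -wE !mulgA; congr (_ * _).
  by rewrite mulgK.
have w_below x : (l x < - M%:Z)%R -> w.1 x = 1.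
  move=> xM; have := @fsfun_trivial_on_orbit A B w.1 (fun i => b ^- i * x).
  rewrite expg0 invg1 mul1g; apply=> [i j /mulIg/invg_inj/(infinite_order_inj level_infinite_order)//|i].
  elim: i => [|i <-]; first by rewrite expg0 invg1 mul1g.
  rewrite expgSr invgM -mulgA; set y := _ * x.
  have lyM : (l y < - M%:Z)%R by rewrite lM levelV levelX; nia.
  have F1 : F y = 1.
    by apply/eqP; apply/negPn/negP => /FM; have := l_norm y; lia.
  have v1 : v.1 y = 1.
    by apply/eqP; apply/negPn/negP => /vM; have := l_norm y; lia.
  by have := wE y; rewrite F1 v1 mulg1 mul1g.
have w1E x : w.1 x = (hG x)^-1 * hF x.
  have [xM|xM] := leP (- M%:Z)%R (l x); last by rewrite hF1 // hG1 // w_below // invg1 mulg1.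
  have := e_above x xM; rewrite eE => /(congr1 (fun t => (hG x)^-1 * (t * hF x))).
  by rewrite mulgVK mulKg mul1g.
have wEE : w = (base hG)^-1 * base hF * top A w.2.
  apply: wreathP => [x|]; last by rewrite !wreath_mul2 wreath_inv2 /= invg1 !mul1g.
  rewrite !wreath_mulE topE mulg1 wreath_invE wreath_inv2 /= invgK !mul1g.
  exact: w1E.
rewrite {1}wEE; apply: word_lengthM_le => //.
rewrite mulnDr addnC; apply: word_lengthM_le => //; first exact: word_lengthV_le.
by rewrite -(weight_shift SA w.2).
Qed.

End Sweep.

(** A coarse substitute for the ball of the word metric, recording just the quantities by which
    conjugators are bounded. *)
Definition inball (n : nat) w := [/\ (norm w.2 <= n)%N,
  forall x, w.1 x != 1 -> (norm x <= n)%N & (weight SA w.1 <= n)%N].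

Lemma top_commutes b x : top A x * top A b = top A b * top A x.
Proof. by rewrite -!topM mulBC. Qed.

Lemma conjugator_moving_cursor n u v : u.2 != 1 -> inball n u -> inball n v ->
  conjugate u v ->
  exists2 w, w * u = v * w & (wl w <= K * (6 * (4 + 8 * R) + 2) * n ^ 2)%N.
Proof.
move=> b1 uB vB [w0 w0u]; case: (uB) (vB) => [bn un fu] [_ vn gv].
set b := u.2 in b1 bn.
have v2 : v.2 = b.
  have : (w0 * u).2 = (v * w0).2 by rewrite w0u.
  by rewrite !wreath_mul2 (mulBC v.2) => /mulgI.
have [l [lM l_norm lb nb]] := level_exists b1.
have len_le := conjugator_length_le lM l_norm lb nb.
(* Either some coset of [<b>] meets both lamp supports, which determines the
   cursor of [w0] modulo [<b>], or [u] and [v] are both conjugate to [b]. *)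
have [|disjoint] := pselect (exists x y i j,
    [/\ v.1 x != 1, u.1 y != 1 & x * b ^+ i = w0.2 * y * b ^+ j]).
  (* Multiplying by powers of [v] keeps a conjugator and moves its cursor by powers of [b], here to
     [x * y^-1], of norm at most [2 * n]. *)
  move=> [x [y [i [j [gx fy xy]]]]]; pose w := v ^- i * (v ^+ j * w0).
  have wu : w * u = v * w.
    rewrite /w -!mulgA w0u !mulgA; congr (_ * _).
    rewrite -!mulgA -expgSr expgS !mulgA; congr (_ * _).
    exact: commute_sym (commuteV (commuteX _ (commute_refl v))).
  have w2 : w.2 = x * y^-1.
    have vX k : (v ^+ k).2 = b ^+ k.
      by elim: k => [|k IHk] //; rewrite !expgS wreath_mul2 IHk v2.
    rewrite !wreath_mul2 wreath_inv2 !vX; apply: (mulIg y); rewrite mulgVK.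
    rewrite -[RHS](mulgK (b ^+ i)) xy -(mulgA (b ^- i)) (mulBC (b ^- i)).
    by rewrite -(mulgA (b ^+ j)) (mulBC (b ^+ j)).
  have nw : (norm w.2 <= 2 * n)%N.
    rewrite w2 (leq_trans (normM _ _)) // normV mul2n -addnn.
    exact: leq_add (vn _ gx) (un _ fy).
  (* [3 * n] is [2 * n] for the cursor plus [n] for a lamp of [u]. *)
  exists w => //; have := len_le (3 * n)%N u v w erefl v2 wu.
  have vM x' : v.1 x' != 1 -> (norm x' <= 3 * n)%N by move/vn; lia.
  have uM x' : u.1 x' != 1 -> (norm (w.2 * x')%g <= 3 * n)%N.
    by move/un => x'n; have := normM w.2 x'; lia.
  move=> /(_ vM uM) /leq_trans; apply; move: nw fu gv.
  move: (norm _) (weight _ _) (weight _ _) => a1 a2 a3 a1n a2n a3n.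
  have -> : (K * (6 * (4 + 8 * R) + 2) * n ^ 2 =
    K * (4 + 8 * R) * (3 * n) * (n + n) + K * (2 * n ^ 2))%N by ring.
  apply: leq_add; first by rewrite leq_mul2l leq_add ?orbT.
  by rewrite leq_mul2l; apply/orP; right; nia.
(* [P] is the union of the cosets of [<b>] meeting the translated support of [u]. By disjointness
   [v] has no lamps there, so the lamps of [w0] on [P] conjugate [u] to [top A b]. *)
pose P x := exists y i j, u.1 y != 1 /\ x * b ^+ i = w0.2 * y * b ^+ j.
have PS x : P (b^-1 * x) <-> P x.
  split=> -[y [i [j [uy xy]]]]; last first.
    exists y, i.+1, j; split=> //; rewrite -xy expgS mulgA; congr (_ * _).
    by rewrite (mulBC _ x) mulgVK.
  exists y, i, j.+1; split=> //; rewrite expgSr mulgA -xy.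
  by rewrite (mulBC _ b) !mulgA mulgV mul1g.
pose hf : {fsfun B -> A with 1} :=
  [fsfun x in finsupp w0.1 => if `[< P x >] then w0.1 x else 1 | 1].
have hfE x : hf x = if `[< P x >] then w0.1 x else 1.
  rewrite fsfunE; case: ifPn => // x0.
  by case: ifP => // _; rewrite fsfun_dflt.
pose w1 : wreath A B := (hf, w0.2).
have w1u : w1 * u = top A b * w1.
  apply: wreathP => [x|]; last by rewrite !wreath_mul2 mulBC.
  rewrite !wreath_mulE topE mul1g /= !hfE (asbool_equiv_eq (PS x)).
  have : (w0 * u).1 x = (v * w0).1 x by rewrite w0u.
  rewrite !wreath_mulE v2; case: asboolP => [Px|nPx].
    suff -> : v.1 x = 1 by rewrite mul1g.
    apply/eqP; apply/negPn/negP => vx; apply: disjoint; case: Px => y [i [j [uy xy]]].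
    by exists x, y, i, j.
  move=> _; suff -> : u.1 (w0.2^-1 * x) = 1 by rewrite mulg1.
  apply/eqP; apply/negPn/negP => ux; apply: nPx; exists (w0.2^-1 * x), 0%N, 0%N.
  by split=> //; rewrite !expg0 !mulg1 mulVKg.
(* Elements of [top] commute with [top A b], so the cursor can be reset to 1. Likewise [wv]
   conjugates [v] to [top A b] with trivial cursor, and [wv^-1 * wu] is then a short conjugator. *)
pose wu := top A w0.2^-1 * w1.
have wuE : wu * u = top A b * wu.
  by rewrite /wu -mulgA w1u mulgA (top_commutes b) -mulgA.
have wu2 : wu.2 = 1 by rewrite wreath_mul2 /= mulVg.
clearbody wu; pose wv := top A w0.2 * (wu * w0^-1).
have wvE : wv * v = top A b * wv.
  have -> : wv * v = top A w0.2 * (wu * u) * w0^-1.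
    rewrite /wv -!mulgA; do 2!congr (_ * _).
    by apply: (mulgI w0); rewrite !mulgA mulgV mul1g w0u mulgK.
  by rewrite wuE /wv !mulgA top_commutes.
have wv2 : wv.2 = 1 by rewrite !wreath_mul2 wu2 wreath_inv2 /= mul1g mulgV.
clearbody wv.
have len_top (t : wreath A B) (w : wreath A B) : inball n t -> t.2 = b ->
    w.2 = 1 -> w * t = top A b * w -> (wl w <= K * (4 + 8 * R) * n * n)%N.
  move=> [_ tn wt] t2 w2 wE.
  have := len_le n t (top A b) w t2 erefl wE.
  rewrite w2 norm1 muln0 addn0 => /(_ _ _)/leq_trans; apply.
  - by move=> x; rewrite topE eqxx.
  - by move=> x; rewrite mul1g; exact: tn.
  by rewrite /= weight1 addn0 leq_mul2l wt orbT.
exists (wv^-1 * wu).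
  apply: (mulgI wv); rewrite mulgA !mulVKg wuE mulgA wvE -mulgA.
  by rewrite mulVKg.
apply: (@leq_trans (K * (4 + 8 * R) * n * n + K * (4 + 8 * R) * n * n)).
  apply: word_lengthM_le => //; last by apply: (len_top u).
  by apply: word_lengthV_le => //; apply: (len_top v).
nia.
Qed.

(* The linear bound [D * m] is additive in [m], so it sums over the lamps; [D]
   may depend on [n]. *)
Lemma conjugator_fixed_cursor n D u v :
  (forall m, (m <= 2 * n)%N -> (CLF SA m <= D * m)%N) ->
  u.2 = 1 -> inball n u -> inball n v -> conjugate u v ->
  exists2 w, w * u = v * w & (wl w <= K * 4 * (n ^ 2 + n * D))%N.
Proof.
move=> CLF_D u2 [_ un fu] [_ vn gv] [w0 w0u].
have v2 : v.2 = 1.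
  have : (w0 * u).2 = (v * w0).2 by rewrite w0u.
  by rewrite !wreath_mul2 (mulBC v.2) u2 => /mulgI.
have w0E x : w0.1 x * u.1 (w0.2^-1 * x) = v.1 x * w0.1 x.
  have : (w0 * u).1 x = (v * w0).1 x by rewrite w0u.
  by rewrite !wreath_mulE v2 invg1 mul1g.
have triv x : v.1 x = 1 -> u.1 (w0.2^-1 * x) = 1.
  by move=> vx; apply: (mulgI (w0.1 x)); rewrite w0E vx mul1g mulg1.
have [[x0 vx0]|v_triv] := pselect (exists x, v.1 x != 1); last first.
  have v1 x : v.1 x = 1.
    by apply/eqP; apply/negPn/negP => vx; apply: v_triv; exists x.
  have -> : u = 1.
    apply: wreathP => [x|]; last by rewrite u2.
    by rewrite wreath_oneE -[x](mulKg w0.2) triv.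
  have -> : v = 1 by apply: wreathP => [x|]; rewrite ?v1 ?wreath_oneE ?v2.
  by exists 1 => //; rewrite word_length1.
(* The cursor carries a lamp of [u] to the lamp of [v] at [x0], both within norm [n]. *)
have nz : (norm w0.2 <= 2 * n)%N.
  have -> : w0.2 = x0 * (w0.2^-1 * x0)^-1 by rewrite invgM invgK mulgA mulgV mul1g.
  rewrite (leq_trans (normM _ _)) // normV mul2n -addnn.
  apply: leq_add (vn _ vx0) (un _ _).
  apply: contra vx0 => /eqP ux0; apply/eqP/(mulIg (w0.1 x0)).
  by rewrite -w0E ux0 mulg1 mul1g.
pose m x := (wlA (u.1 (w0.2^-1 * x)%g) + wlA (v.1 x))%N.
have cP x : exists c : A, c * u.1 (w0.2^-1 * x) = v.1 x * c /\
    (wlA c <= CLF SA (m x))%N.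
  have [c cu cl] := CLF_conjugator genSA (leqnn (m x)) (ex_intro _ _ (w0E x)).
  by exists c.
have [c cE] := choice cP.
(* The cursor of [w0] is kept, but each lamp is replaced by a short conjugator in [A], and only
   where [v] is lit. *)
pose h : {fsfun B -> A with 1} := [fsfun x in finsupp v.1 => c x | 1].
have hE x : h x = if v.1 x == 1 then 1 else c x.
  by rewrite fsfunE mem_finsupp; case: eqP.
have supp_h : (finsupp h `<=` finsupp v.1)%fset.
  by apply/fsubsetP => x; rewrite !mem_finsupp hE; case: (v.1 x =P 1); rewrite // eqxx.
have m_sum : (\sum_(x <- finsupp v.1) m x <= 2 * n)%N.
  rewrite big_split /= mul2n -addnn leq_add //.
  apply: leq_trans fu; rewrite -(weight_shift SA w0.2).
  rewrite (@weight_incl _ _ _ _ (finsupp v.1)).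
    by apply: leq_sum => x _; rewrite fsfun_shiftE.
  apply/fsubsetP => x; rewrite !mem_finsupp fsfun_shiftE.
  by apply: contra => /eqP/triv->.
have weight_h : (weight SA h <= 2 * n * D)%N.
  rewrite (weight_incl SA supp_h); apply: leq_trans (leq_mul m_sum (leqnn D)).
  rewrite big_distrl /= !big_seq; apply: leq_sum => x xv.
  rewrite hE; case: (v.1 x =P 1) => [_|_]; first by rewrite word_length1.
  have [_ /leq_trans] := cE x; apply; rewrite mulnC; apply: CLF_D.
  apply: leq_trans m_sum.
  by rewrite (big_fsetD1 x) //= leq_addr.
have card_h : (#|` finsupp h| <= n)%N.
  apply: leq_trans gv; apply: leq_trans (card_finsupp_weight _).
  exact: fsubset_leq_card.
exists (base h * top A w0.2).
  apply: wreathP => [x|]; last by rewrite !wreath_mul2 /= u2 v2 mulg1 !mul1g.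
  rewrite !(wreath_mulE, topE, wreath_mul2) /= v2 !(invg1, mul1g, mulg1) !hE.
  case: (v.1 x =P 1) => [vx|_]; last by have [] := cE x.
  by rewrite triv // vx.
have hn x : h x != 1 -> (norm x <= n)%N.
  by rewrite hE; case: (eqVneq (v.1 x) 1) => [|/vn//]; rewrite eqxx.
apply: (@leq_trans (K * (2 * n * n + 2 * n * D) + K * (2 * n))).
  apply: word_lengthM_le => //.
    apply: leq_trans (wl_base hn) _; rewrite leq_mul2l leq_add ?orbT //.
    by rewrite leq_mul2l card_h orbT.
  by apply: leq_trans (wl_top _) _; rewrite leq_mul2l nz orbT.
by rewrite -(mulnDr K) -(mulnA K) leq_mul2l; apply/orP; right; nia.
Qed.

(** The slope [D] comes after [n]: a bound of order [m ^ a] on [CLF SA] is linear on the range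
    considered, with slope of order [n ^ (a - 1)]. *)
Lemma CLF_upper_bound : exists c, forall n D,
  (forall m, (m <= c * n)%N -> (CLF SA m <= D * m)%N) ->
  (CLF S n <= c * (n ^ 2 + n * D))%N.
Proof.
have [k inK] : exists k, forall w, inball (k * wl w) w.
  apply: (word_length_dominates genS) => //.
  - split; rewrite ?norm1 ?weight1 // => x.
    by rewrite wreath_oneE eqxx.
  - move=> m n u v [um fu wu] [vn gv wv]; split.
    + by apply: leq_trans (normM _ _) _; exact: leq_add.
    + move=> x; rewrite wreath_mulE; case: (eqVneq (u.1 x) 1) => [->|ux _].
        rewrite mul1g => /gv nx; have := normM u.2 (u.2^-1 * x); rewrite mulVKg.
        by move/leq_trans; apply; exact: leq_add.
      by apply: leq_trans (fu _ ux) _; exact: leq_addr.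
    + apply: leq_trans (weightM genSA _ _) _.
      by rewrite weight_shift leq_add.
  - move=> m n u mn [um fu wu]; split; [exact: leq_trans mn| |exact: leq_trans mn].
    by move=> x /fu/leq_trans; apply.
  move=> w; exists (norm w.2 + \sum_(x <- finsupp w.1) norm x + weight SA w.1)%N.
  split; [by rewrite -addnA leq_addr| |by rewrite leq_addl].
  move=> x wx; rewrite (big_fsetD1 x) ?mem_finsupp //=; lia.
pose c1 := (K * (6 * (4 + 8 * R) + 2) + K * 4)%N.
(* [2 * k] makes the range of [CLF_D] wide enough; the other terms bound the coefficients of [n ^ 2]
   and [n * D]. *)
exists (2 * k + c1 * k ^ 2 + c1 * k)%N => n D CLF_D; apply: CLF_le => // u v uvn uv.
have inball_mono w : (wl w <= n)%N -> inball (k * n) w.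
  move=> wn; have [wa wb wc] := inK w.
  have kn : (k * wl w <= k * n)%N by rewrite leq_mul2l wn orbT.
  split; [exact: leq_trans kn| |exact: leq_trans kn].
  by move=> x /wb/leq_trans; apply.
have uk := inball_mono u (leq_trans (leq_addr _ _) uvn).
have vk := inball_mono v (leq_trans (leq_addl _ _) uvn).
have [u1|u1] := eqVneq u.2 1.
  have [m mn|w wu wlw] := @conjugator_fixed_cursor (k * n) D u v _ u1 uk vk uv.
    by apply: CLF_D; apply: leq_trans mn _; nia.
  exists w => //; apply: leq_trans wlw _; rewrite /c1; nia.
have [w wu wlw] := conjugator_moving_cursor u1 uk vk uv.
by exists w => //; apply: leq_trans wlw _; rewrite /c1; nia.
Qed.

End CLFUpperBound.

(** * The lattice Z^r *)

Section IntegerLattice.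
Variable r : nat.
Implicit Types (x y b : Zpow r) (i : 'I_r).

Definition coord x i : int := (x : 'rV[int]_r) ord0 i.
Definition unit_vector i : Zpow r := delta_mx ord0 i.
Definition l1norm x : nat := (\sum_(i < r) `|coord x i|)%N.

Lemma coordM x y i : coord (x * y) i = (coord x i + coord y i)%R.
Proof. by rewrite /coord; exact: mxE. Qed.

Lemma coord1 i : coord 1 i = 0%R.
Proof. by rewrite /coord; exact: mxE. Qed.

Lemma coordV x i : coord x^-1 i = (- coord x i)%R.
Proof. by have := coordM x x^-1 i; rewrite mulgV coord1; lia. Qed.

Lemma coordX x n i : coord (x ^+ n) i = (coord x i * n%:Z)%R.
Proof.
elim: n => [|n IHn]; first by rewrite expg0 coord1 mulr0.
by rewrite expgS coordM IHn; lia.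
Qed.

Lemma coord_unit i j : coord (unit_vector i) j = ((i == j)%:Z)%R.
Proof. by rewrite /coord /unit_vector mxE eqxx /= eq_sym; case: eqP. Qed.

Lemma coordP x y : coord x =1 coord y -> x = y.
Proof. by move=> xy; apply/rowP => i; exact: xy. Qed.

Lemma ZpowC x y : x * y = y * x.
Proof. by apply: coordP => i; rewrite !coordM addrC. Qed.

Lemma unit_vector_independent i j : i != j -> forall k l k' l',
  unit_vector i ^+ k * unit_vector j ^+ l =
  unit_vector i ^+ k' * unit_vector j ^+ l' -> k = k' /\ l = l'.
Proof.
move=> ij k l k' l' e.
have ei := congr1 (coord ^~ i) e; have ej := congr1 (coord ^~ j) e.
move: ei ej; rewrite !coordM !coordX !coord_unit !eqxx (negPf ij) eq_sym (negPf ij).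
by move=> ? ?; split; lia.
Qed.

Lemma l1norm1 : l1norm 1 = 0%N.
Proof. by rewrite /l1norm big1 // => i _; rewrite coord1. Qed.

Lemma l1normM x y : (l1norm (x * y)%g <= l1norm x + l1norm y)%N.
Proof.
rewrite -big_split /=; apply: leq_sum => i _.
by rewrite coordM; lia.
Qed.

Lemma l1normV x : l1norm x^-1 = l1norm x.
Proof. by apply: eq_bigr => i _; rewrite coordV; lia. Qed.

Lemma l1norm_neq0 x : l1norm x != 0%N -> exists i, coord x i != 0%R.
Proof.
rewrite sum_nat_eq0 negb_forall => /existsP[i xi].
by exists i; move: xi; rewrite /= absz_eq0.
Qed.

(** One step by a unit vector or its inverse, towards the origin, lowers the norm by exactly one. *)
Lemma lipschitz_l1norm (L : Zpow r -> nat) :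
  L 1 = 0%N -> (forall x y, (L (x * y)%g <= L x + L y)%N) ->
  exists K, forall x, (L x <= K * l1norm x)%N.
Proof.
move=> L1 LM; pose Li i := (L (unit_vector i) + L (unit_vector i)^-1)%N.
exists (\sum_(i < r) Li i)%N => x; have [n] := ubnP (l1norm x).
elim: n x => // n IHn x xn; have [x0|x_neq0] := eqVneq (l1norm x) 0%N.
  suff -> : x = 1 by rewrite L1.
  apply: coordP => i; rewrite coord1; apply/eqP; rewrite -absz_eq0.
  by move/eqP: x0; rewrite sum_nat_eq0 => /forallP/(_ i).
have [i xi] := l1norm_neq0 x_neq0.
have [e [Le ei ej]] : exists e, [/\ (L e <= Li i)%N,
    (`|coord (e^-1 * x)%g i|.+1 = `|coord x i|)%N &
    forall j, j != i -> coord (e^-1 * x) j = coord x j].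
  have [xi_gt0|xi_le0] := ltP 0%R (coord x i).
    exists (unit_vector i); split=> [||j ji]; first exact: leq_addr.
      by rewrite coordM coordV coord_unit eqxx; lia.
    by rewrite coordM coordV coord_unit eq_sym (negPf ji) oppr0 add0r.
  exists (unit_vector i)^-1; split=> [||j ji]; first exact: leq_addl.
    by rewrite invgK coordM coord_unit eqxx; move/eqP: xi => xi; lia.
  by rewrite invgK coordM coord_unit eq_sym (negPf ji) add0r.
have xE : l1norm x = (l1norm (e^-1 * x)%g).+1.
  rewrite /l1norm (bigD1 i) //= [in RHS](bigD1 i) //= -ei addSn; congr (_ + _).+1%N.
  by apply: eq_bigr => j ji; rewrite ej.
rewrite -[x in L x](mulVKg e) xE mulnS (leq_trans (LM _ _)) // leq_add //.
  by apply: leq_trans Le _; rewrite (bigD1 i) //= leq_addr.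
by apply: IHn; move: xn; rewrite xE ltnS.
Qed.

(** The level is, up to sign, the coordinate at which [b] is largest in absolute value; the norm of
    [b] is at most [r] times that value. *)
Lemma level_function b : b != 1 -> exists l : Zpow r -> int,
  [/\ forall x y, l (x * y) = (l x + l y)%R, forall x, (`|l x| <= l1norm x)%N,
      (0 < l b)%R & (l1norm b <= r * `|l b|)%N].
Proof.
move=> b1; have [i0 bi0] : exists i, coord b i != 0%R.
  apply: l1norm_neq0; apply: contra b1; rewrite sum_nat_eq0 => /forallP b0.
  apply/eqP/coordP => i; rewrite coord1; apply/eqP.
  by have := b0 i; rewrite /= absz_eq0.
have [i _ imax] := @arg_maxnP _ i0 predT (fun i => `|coord b i|%N) isT.
have bi : coord b i != 0%R.
  by have := imax i0 isT; rewrite -absz_eq0; move: bi0; rewrite -absz_eq0; lia.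
have sgi : `|sgz (coord b i)|%N = 1%N by have := normr_sgz (coord b i); rewrite bi /=; lia.
exists (fun x => sgz (coord b i) * coord x i)%R; split=> [x y|x||].
- by rewrite coordM mulrDr.
- rewrite abszM sgi mul1n /l1norm (bigD1 i) //=; exact: leq_addr.
- by rewrite -abszEsg; lia.
rewrite abszM sgi mul1n -[r in (r * _)%N]card_ord -sum_nat_const.
by apply: leq_sum => j _; exact: imax.
Qed.

End IntegerLattice.

(** * Comparison of growth functions *)

Section Comparison.
Variable R : realType.
Implicit Types (f g h : nat -> R).
Local Open Scope ring_scope.

Lemma preceq_nat (f g : nat -> nat) K : {homo g : m n / (m <= n)%N} ->
  (forall n, (f n <= K * g (K * n))%N) ->
  preceq (fun n => (f n)%:R : R) (fun n => (g n)%:R).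
Proof.
move=> g_homo fg; exists K.+1; split=> // n; rewrite -natrM ler_nat.
apply: leq_trans (fg n) _; rewrite leq_mul // g_homo //.
by rewrite leq_mul2r leqnSn orbT.
Qed.

Lemma preceq_trans f g h : preceq f g -> preceq g h -> preceq f h.
Proof.
move=> [C [C_gt0 fg]] [D [D_gt0 gh]]; exists (C * D)%N; rewrite muln_gt0 C_gt0.
split=> // n; apply: le_trans (fg n) _; rewrite natrM -mulrA ler_wpM2l //.
by rewrite -mulnA mulnCA; exact: gh.
Qed.

Lemma power2 : power 2 = square R.
Proof. by apply/funext => n; rewrite /power /square (powR_mulrn 2). Qed.


Section LatticeUpperBound.
Variables (A : groupType) (r : nat) (SA : seq A) (S : seq (wreath A (Zpow r))).
Hypothesis genSA : generated SA = setT.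
Hypothesis genS : generated S = setT.

Lemma CLF_lattice_upper_bound : exists c, forall n D,
  (forall m, (m <= c * n)%N -> (CLF SA m <= D * m)%N) ->
  (CLF S n <= c * (n ^ 2 + n * D))%N.
Proof.
have [K1 topK] : exists K, forall x : Zpow r, (word_length S (top A x) <= K * l1norm x)%N.
  apply: (@lipschitz_l1norm _ (fun x => word_length S (top A x))).
    by rewrite top1 word_length1.
  by move=> x y; rewrite topM; exact: word_lengthM.
have [K2 lampK] := @wl_lamp_lipschitz _ (Zpow r) S genS SA genSA.
apply: (@CLF_upper_bound A (Zpow r) SA S genSA genS (@ZpowC r) (@l1norm r) r
  (K1 + K2) (l1norm1 r) (@l1normM r) (@l1normV r) (@level_function r)) => [x|a].
  by apply: leq_trans (topK x) _; rewrite leq_mul2r leq_addr orbT.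
by apply: leq_trans (lampK a) _; rewrite leq_mul2r leq_addl orbT.
Qed.

Lemma CLF_lattice_preceq_power (a : R) : 2 <= a ->
  preceq (CLFr R SA) (power a) -> preceq (CLFr R S) (power a).
Proof.
move=> a2 [C [C_gt0 CLF_A]]; have [c CLF_c] := CLF_lattice_upper_bound.
have a_gt0 : 0 < a by exact: lt_le_trans a2.
have a1_ge0 : 0 <= a - 1 by rewrite subr_ge0 (le_trans _ a2) // ler1n.
(* Chosen so that [C (C m)^a <= k n^(a - 1) m] whenever [m <= c n]. *)
pose k : R := C%:R ^+ 2 * (C * c)%N%:R `^ (a - 1).
have k_ge0 : 0 <= k by rewrite mulr_ge0 ?exprn_ge0 ?powR_ge0.
(* The 2 accounts for [n ^ 2] and for the [n] lost in rounding the slope up to the integer [D.+1],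
   each at most [n^a]. *)
pose E : R := c%:R * (2 + k).
have E_ge0 : 0 <= E by rewrite mulr_ge0 // addr_ge0.
have E_lt : E <= (Num.truncn E).+1%:R by apply: ltW; have /andP[] := truncn_itv E_ge0.
have CLF_n n : (CLF S n)%:R <= E * n%:R `^ a.
  pose y : R := k * n%:R `^ (a - 1); have y_ge0 : 0 <= y by rewrite mulr_ge0 ?powR_ge0.
  have /andP[D_le D_gt] := truncn_itv y_ge0; set D := Num.truncn y in D_le D_gt.
  have CLF_D m : (m <= c * n)%N -> (CLF SA m <= D.+1 * m)%N.
    move=> mn; rewrite -(ler_nat R) natrM; apply: le_trans (CLF_A m) _.
    apply: (@le_trans _ _ (y * m%:R)); last by rewrite ler_wpM2r // ltW.
    rewrite /power -mulr_powRB1 //.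
    have m_le : (C * m)%N%:R `^ (a - 1) <= (C * c)%N%:R `^ (a - 1) * n%:R `^ (a - 1) :> R.
      rewrite -powRM // ge0_ler_powR ?nnegrE // -natrM ler_nat -mulnA.
      by rewrite leq_mul2l mn orbT.
    apply: le_trans (ler_wpM2l _ (ler_wpM2l _ m_le)) _ => //.
    by rewrite /y /k natrM le_eqVlt; apply/orP; left; apply/eqP; ring.
  (* The comparison of powers below needs a base at least 1; at [n = 0] slope 0 suffices, as
     [CLF SA 0] is 0. *)
  have [->|n_gt0] := posnP n.
    rewrite powR0 ?gt_eqF // mulr0 -(mulr0n 1) ler_nat.
    apply: leq_trans (CLF_c 0%N 0%N _) _; last by rewrite mul0n muln0.
    move=> m; rewrite muln0 leqn0 => /eqP->; rewrite muln0 -(ler_nat R).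
    by apply: le_trans (CLF_A _) _; rewrite /power muln0 powR0 ?gt_eqF // mulr0.
  have n_ge1 : 1 <= n%:R :> R by rewrite ler1n.
  have := CLF_c n D.+1 CLF_D; rewrite -(ler_nat R) => /le_trans; apply.
  rewrite natrM /E -mulrA ler_wpM2l // natrD natrX natrM.
  have n2_le : n%:R ^+ 2 <= n%:R `^ a :> R by rewrite -(powR_mulrn 2) // ler_powR.
  have n_le : n%:R <= n%:R `^ a :> R by rewrite le1r_powR // (le_trans _ a2) // ler1n.
  have ny : n%:R * y = k * n%:R `^ a by rewrite /y mulrCA mulr_powRB1.
  have D1 : D.+1%:R <= y + 1 by rewrite -natr1 lerD2r.
  have := ler_wpM2l (ler0n R n) D1; rewrite mulrDr ny mulr1 => nD.
  rewrite mulrDl; lra.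
exists (Num.truncn E).+1; split=> // n; apply: le_trans (CLF_n n) _.
apply: ler_pM; rewrite ?powR_ge0 //.
by apply: ge0_ler_powR; rewrite ?nnegrE ?(ltW a_gt0) // ler_nat leq_pmull.
Qed.

End LatticeUpperBound.
End Comparison.

Local Open Scope ring_scope.
Local Open Scope classical_set_scope.

Theorem theorem3 (R : realType) (A B : groupType)
    (hA : finitely_generated A) (hB : finitely_generated B)
    (A_nontrivial : exists a : A, a != 1%g) :
  [/\ ~ virtually_cyclic B ->
      forall x : B, infinite_order x -> central x ->
      forall (S : seq (wreath A B)) (T X : seq B),
        generated S = setT -> generated T = setT ->
        generated X = generated [:: x] ->
        preceq (distortionr R T X) (CLFr R S),

      contains_copy_of B (Zpow 2) ->
      forall S : seq (wreath A B), generated S = setT ->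
        preceq (square R) (CLFr R S)
    & forall r : nat, (2 <= r)%N -> moderate_CLF R A ->
      exists2 a : R, 2 <= a <= 3 &
        forall S : seq (wreath A (Zpow r)), generated S = setT ->
          asymp (CLFr R S) (power a)].
Proof.
have square_preceq (B' : groupType) (S : seq (wreath A B')) (p q : B') :
    generated S = setT ->
    (forall i j k l, (p ^+ i * q ^+ j)%g = (p ^+ k * q ^+ l)%g -> i = k /\ j = l) ->
    preceq (square R) (CLFr R S).
  move=> genS /(CLF_square genS A_nontrivial)[K nK].
  have -> : square R = fun n => (n ^ 2)%N%:R by apply/funext => n; rewrite natrX.
  by apply: (@preceq_nat R (fun n => n ^ 2)%N _ K) nK; exact: CLF_mono.
have e01 : @ord0 1 != lift ord0 ord0 by [].
split=> [_ x x_inf _ S T X genS genT genX|[H [_ [f fM f_bij]]] S genS|r r2 [SA genSA modA]].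
- have [K nK] := CLF_distortion genS A_nontrivial x_inf genT genX.
  by apply: (@preceq_nat R (distortion T X) _ K) nK; exact: CLF_mono.
- have fX x n : f (x ^+ n)%g = (f x ^+ n)%g.
    elim: n => [|n IHn]; last by rewrite !expgS fM IHn.
    (* Only multiplicativity of [f] is given, so [f 1 = 1] comes from cancellation. *)
    by apply: (mulgI (f 1%g)); rewrite expg0 -fM !mulg1.
  apply: (@square_preceq _ _ (f (unit_vector ord0)) (f (unit_vector (lift ord0 ord0)))) => //.
  move=> i j k l; rewrite -!fX -!fM => e.
  apply: (unit_vector_independent e01).
  by apply: (set_bij_inj f_bij) e; rewrite in_setT.
case: r r2 => [//|[//|r]] _.
have square_CLF (S : seq (wreath A (Zpow r.+2))) : generated S = setT -> preceq (square R) (CLFr R S).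
  move=> genS; have e01' : @ord0 r.+1 != lift ord0 ord0 by [].
  exact: (@square_preceq (Zpow r.+2) S _ _ genS (unit_vector_independent e01')).
(* The exponent is read off from [A] before [S] is given. The lower bound comes from the planar grid
   in the first case and from the lamp group in the second. *)
case: modA => [CLF_A|[b b23 [CLF_Ab bCLF_A]]].
  exists 2; first by rewrite lexx ler_nat.
  move=> S genS; split; last by rewrite power2; exact: square_CLF.
  by apply: (CLF_lattice_preceq_power genSA) => //; rewrite power2.
exists b => // S genS; case/andP: b23 => b2 b3; split.
  exact (CLF_lattice_preceq_power genSA genS b2 CLF_Ab).
apply: preceq_trans bCLF_A _; have [K nK] := CLF_lamp_group genS genSA.
by apply: (@preceq_nat R (CLF SA) _ K) nK; exact: CLF_mono.
Qed.
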